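(* For $\operatorname{Re}(z)\ge 0$ and $\operatorname{Re}(b)\ge-\frac12$, $$E_{a,b}(-z)=\frac{2^{2b-1}}{\sqrt{\pi}}\int_{0}^{\infty}t^{b-\frac12}e^{-t}E_{2a,2b}\left(-z(4t)^{a}\right)dt .$$ Alternatively, for $\operatorname{Re}(b)\ge\frac12$ and $\operatorname{Re}(z)\ge 0$, $$E_{a,b}(-z)=\frac{2^{2(b-1)}}{\sqrt{\pi}}\int_{0}^{\infty}t^{b-\frac32}e^{-t}E_{2a,2b-1}\left(-z(4t)^{a}\right)dt ,$$ which also applies to $E_{a}(z)=E_{a,1}(z)$ after choosing $b=1$.
   Context: The Mittag-Leffler function is $E_{a,b}(z)=\sum_{k=0}^{\infty}\frac{z^{k}}{\Gamma(b+ak)}$ for $\operatorname{Re}(a)>0$ and complex $b$, with $1/\Gamma$ the entire reciprocal Gamma function.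
   Formalization: The identities are proved for Re(b) > -1/2 and Re(b) > 1/2; on the lines Re(b) = -1/2 and Re(b) = 1/2, where they fail (the integral diverges or loses its k=0 term), the right-hand side is taken as the limit from larger Re(b). *)

(* Defs.v *)
From Stdlib Require Import Reals Factorial.
From Coquelicot Require Import Coquelicot.
Open Scope R_scope.

Definition Clim_seq (u : nat -> C) : C :=
  iota (T := C_R_CompleteNormedModule)
    (fun l => filterlim u eventually (locally l)).

Definition CSeries (u : nat -> C) : C :=
  iota (T := C_R_CompleteNormedModule)
    (fun l => is_series (V := C_R_NormedModule) u l).

Definition Cexp (z : C) : C :=
  (exp (Re z) * cos (Im z), exp (Re z) * sin (Im z)).

(* Principal power; only meaningful for t > 0. *)
Definition Rcpow (t : R) (s : C) : C := Cexp (s * RtoC (ln t))%C.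

Fixpoint rising (z : C) (n : nat) : C :=
  match n with
  | O => RtoC 1
  | S m => (rising z m * (z + RtoC (INR m)))%C
  end.

(* Gauss's product formula
     1 / Gamma(z) = lim_n z (z + 1) ... (z + n) / (n! n^z),
   which converges for every complex z (it vanishes at 0, -1, -2, ...), so no
   separate analytic continuation is needed. *)
Definition rGamma (z : C) : C :=
  Clim_seq (fun n =>
    (rising z (S n) / (RtoC (INR (fact n)) * Rcpow (INR n) z))%C).

Definition mittag_leffler (a b z : C) : C :=
  CSeries (fun k => (z ^ k * rGamma (b + a * RtoC (INR k)))%C).

Definition mittag_leffler1 (a z : C) : C := mittag_leffler a (RtoC 1) z.

(* Improper integrals over (0, +oo), with limits taken at both endpoints. *)
Definition ex_CInt_0_inf (f : R -> C) : Prop :=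
  ex_RInt_gen (V := C_R_NormedModule) f (at_right 0) (Rbar_locally p_infty).

Definition CInt_0_inf (f : R -> C) : C :=
  RInt_gen (V := C_R_CompleteNormedModule) f
    (at_right 0) (Rbar_locally p_infty).

Definition integrand1 (a b z : C) (t : R) : C :=
  (Rcpow t (b - RtoC (1 / 2)) * RtoC (exp (- t))
   * mittag_leffler (RtoC 2 * a) (RtoC 2 * b) (- z * Rcpow (4 * t) a))%C.

Definition rhs1 (a b z : C) : C :=
  (Rcpow 2 (RtoC 2 * b - RtoC 1) / RtoC (sqrt PI)
   * CInt_0_inf (integrand1 a b z))%C.

Definition integrand2 (a b z : C) (t : R) : C :=
  (Rcpow t (b - RtoC (3 / 2)) * RtoC (exp (- t))
   * mittag_leffler (RtoC 2 * a) (RtoC 2 * b - RtoC 1)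
       (- z * Rcpow (4 * t) a))%C.

Definition rhs2 (a b z : C) : C :=
  (Rcpow 2 (RtoC 2 * (b - RtoC 1)) / RtoC (sqrt PI)
   * CInt_0_inf (integrand2 a b z))%C.

(* Limit as b' -> b through the open half-plane Re b' > c.  It gives a meaning
   to the right-hand sides on the boundary line Re b' = c, where the improper
   integral itself either diverges (b not real) or misses the k = 0 term of the
   series (b = c). *)
Definition is_lim_half_plane (c : R) (f : C -> C) (b l : C) : Prop :=
  filterlim f
    (within (fun b' : C => c < Re b')
       (locally (T := C_R_NormedModule) b))
    (locally (T := C_R_NormedModule) l).

(* Main.v *)
Require Import Defs.
From Stdlib Require Import Reals Factorial Lra Lia Psatz.
From Stdlib Require FunctionalExtensionality.
From Coquelicot Require Import Coquelicot.
Open Scope R_scope.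

(** Expand the Mittag-Leffler function under the integral sign. By Euler's integral
    the k-th term of the integrand integrates to a multiple of
    Gamma(c + a k) / Gamma(2 p + 2 a k), where p = b, c = b + 1/2 in the first
    formula and p = c = b - 1/2 in the second. Legendre's duplication formula
    ([rGamma_duplication]) turns this ratio into a constant times
    4^(- a k) / Gamma(b + a k), so that the integrated series is again a
    Mittag-Leffler series. This computation is [subordination].

    Since rGamma is defined by Gauss's product, Euler's integral has to be
    identified with its inverse ([rGamma_GammaC]). For 1 <= Re s <= 2 this is a
    concentration estimate for the density t^n e^(-t) / n! near t = n
    ([Gamma_concentration]); the functional equation does the rest, and makes
    Gauss's product converge in the whole plane. Duplication is then an identity
    between Gauss quotients, whose constant is rGamma(1/2), computed from Wallis's
    product ([rGamma_half]).

    The exchange of sum and integral ([ImpInt_series]) needs absolute convergence.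
    For complex a the argument b + a k moves in a sector, and there
    |rGamma(s)| Gamma(Re s) is at most exponential in Re s ([rGamma_imag_bound]),
    while Gamma(Re s) outgrows every geometric sequence; hence rGamma(b + a k)
    decays faster than any geometric sequence ([rGamma_decay]). The same bound,
    uniform in b, makes the Mittag-Leffler function continuous in b
    ([mittag_leffler_continuous]), and this gives the limits on the boundary lines. *)

(** * Limits of complex-valued functions *)

Lemma norm_Cmod (z : C) : norm (V := C_R_NormedModule) z = Cmod z.
Proof. symmetry; apply Cmod_norm. Qed.

Lemma filterlim_C {T} (F : (T -> Prop) -> Prop) {FF : Filter F}
  (f : T -> C) (l : C) :
  filterlim f F (locally (T := C_R_NormedModule) l) <->
  forall eps, 0 < eps -> F (fun x => Cmod (f x - l)%C < eps).
Proof.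
  split; intros H.
  - intros eps He.
    pose proof (proj1 (filterlim_locally_ball_norm (U := C_R_NormedModule) f l) H
      (mkposreal eps He)) as H1.
    revert H1; apply filter_imp; intros x Hx.
    unfold ball_norm in Hx; rewrite norm_Cmod in Hx; exact Hx.
  - apply (filterlim_locally_ball_norm (U := C_R_NormedModule)); intros eps.
    generalize (H eps (cond_pos eps)); apply filter_imp; intros x Hx.
    unfold ball_norm; rewrite norm_Cmod; exact Hx.
Qed.

Lemma filterlim_C_le {T} (F : (T -> Prop) -> Prop) {FF : Filter F}
  (f : T -> C) (l : C) (g : T -> R) :
  F (fun x => Cmod (f x - l)%C <= g x) -> filterlim g F (locally 0) ->
  filterlim f F (locally (T := C_R_NormedModule) l).
Proof.
  intros Hle Hg; apply filterlim_C; [exact FF |]; intros eps He.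
  pose proof (proj1 (filterlim_locally g 0) Hg (mkposreal eps He)) as H1.
  generalize (filter_and _ _ Hle H1); apply filter_imp; intros x [H2 H3].
  apply Rle_lt_trans with (1 := H2).
  change (Rabs (g x - 0) < eps) in H3; rewrite Rminus_0_r in H3.
  apply Rle_lt_trans with (2 := H3), Rle_abs.
Qed.

Lemma filterlim_C_norm {T} (F : (T -> Prop) -> Prop) {FF : Filter F}
  (f : T -> C) (l : C) :
  filterlim f F (locally (T := C_R_NormedModule) l) ->
  filterlim (fun x => Cmod (f x - l)%C) F (locally 0).
Proof.
  intros H; apply filterlim_locally; intros eps.
  generalize (proj1 (filterlim_C F f l) H eps (cond_pos eps)).
  apply filter_imp; intros x Hx.
  change (Rabs (Cmod (f x - l)%C - 0) < eps).
  rewrite Rminus_0_r, Rabs_pos_eq by apply Cmod_ge_0; exact Hx.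
Qed.

Lemma filterlim_R_mult {T} (F : (T -> Prop) -> Prop) {FF : Filter F}
  (f g : T -> R) (a b : R) :
  filterlim f F (locally a) -> filterlim g F (locally b) ->
  filterlim (fun x => f x * g x) F (locally (a * b)).
Proof.
  intros Hf Hg; eapply filterlim_comp_2; [exact Hf | exact Hg |].
  apply (filterlim_mult (K := R_AbsRing) a b).
Qed.

Lemma filterlim_R_plus {T} (F : (T -> Prop) -> Prop) {FF : Filter F}
  (f g : T -> R) (a b : R) :
  filterlim f F (locally a) -> filterlim g F (locally b) ->
  filterlim (fun x => f x + g x) F (locally (a + b)).
Proof.
  intros Hf Hg; eapply filterlim_comp_2; [exact Hf | exact Hg |].
  apply (filterlim_plus (V := R_NormedModule) a b).
Qed.

Lemma filterlim_C_mult {T} (F : (T -> Prop) -> Prop) {FF : Filter F}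
  (f g : T -> C) (a b : C) :
  filterlim f F (locally (T := C_R_NormedModule) a) ->
  filterlim g F (locally (T := C_R_NormedModule) b) ->
  filterlim (fun x => (f x * g x)%C) F (locally (T := C_R_NormedModule) (a * b)%C).
Proof.
  intros Hf Hg.
  apply (filterlim_C_norm F) in Hf; apply (filterlim_C_norm F) in Hg.
  apply filterlim_C_le with (g := fun x => Cmod (f x - a)%C * Cmod (g x - b)%C
     + (Cmod (f x - a)%C * Cmod b + Cmod a * Cmod (g x - b)%C)); try exact FF.
  - apply filter_forall; intros x.
    rewrite <- !Cmod_mult.
    replace (f x * g x - a * b)%C with ((f x - a) * (g x - b)
      + ((f x - a) * b + a * (g x - b)))%C by ring.
    eapply Rle_trans; [apply Cmod_triangle |].
    apply Rplus_le_compat_l, Cmod_triangle.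
  - replace (locally 0) with (locally (0 * 0 + (0 * Cmod b + Cmod a * 0)))
      by (f_equal; ring).
    apply filterlim_R_plus; [exact FF | apply filterlim_R_mult; assumption |].
    apply filterlim_R_plus; [exact FF | |]; apply filterlim_R_mult; try assumption;
      apply filterlim_const.
Qed.

Lemma filterlim_C_plus {T} (F : (T -> Prop) -> Prop) {FF : Filter F}
  (f g : T -> C) (a b : C) :
  filterlim f F (locally (T := C_R_NormedModule) a) ->
  filterlim g F (locally (T := C_R_NormedModule) b) ->
  filterlim (fun x => (f x + g x)%C) F (locally (T := C_R_NormedModule) (a + b)%C).
Proof.
  intros Hf Hg; eapply filterlim_comp_2; [exact Hf | exact Hg |].
  apply (filterlim_plus (V := C_R_NormedModule) a b).
Qed.

(** * Improper integrals over the positive half-line *)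

(** In relational form, existence is carried along with the value. *)
Definition ImpInt {V : NormedModule R_AbsRing} (f : R -> V) (l : V) :=
  is_RInt_gen f (at_right 0) (Rbar_locally p_infty) l.

Lemma at_right_0_infty_spec (P : R * R -> Prop) :
  filter_prod (at_right 0) (Rbar_locally p_infty) P <->
  exists d M, 0 < d /\ forall u v, 0 < u < d -> M < v -> P (u, v).
Proof.
  split.
  - intros [Q S [d Hd] [M HM] HP]; exists d, M; split; [apply cond_pos |].
    intros u v Hu Hv; apply HP; [apply Hd; [| tauto] | apply HM, Hv].
    change (Rabs (u - 0) < d); rewrite Rminus_0_r, Rabs_pos_eq; lra.
  - intros (d & M & Hd & H).
    apply Filter_prod with (Q := fun u => 0 < u < d) (R := fun v => M < v).
    + exists (mkposreal d Hd); intros y Hy Hy0; split; [exact Hy0 |].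
      change (Rabs (y - 0) < d) in Hy; rewrite Rminus_0_r, Rabs_pos_eq in Hy; lra.
    + exists M; tauto.
    + intros; apply H; assumption.
Qed.

Lemma ImpInt_spec {V : NormedModule R_AbsRing} (f : R -> V) (l : V) :
  ImpInt f l <->
  forall eps, 0 < eps -> exists d M, 0 < d /\ forall u v, 0 < u < d -> M < v ->
    exists I, is_RInt f u v I /\ norm (minus I l) < eps.
Proof.
  unfold ImpInt, is_RInt_gen; split.
  - intros H eps He.
    assert (HP : locally l (ball_norm l (mkposreal eps He)))
      by (apply locally_le_locally_norm, locally_norm_ball_norm).
    apply H in HP; apply at_right_0_infty_spec in HP.
    destruct HP as (d & M & Hd & HP); exists d, M; split; [exact Hd |].
    intros u v Hu Hv; destruct (HP u v Hu Hv) as [I [HI1 HI2]].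
    exists I; split; [exact HI1 | exact HI2].
  - intros H P HP.
    apply locally_norm_le_locally in HP; destruct HP as [eps HP].
    destruct (H eps (cond_pos eps)) as (d & M & Hd & H1).
    apply at_right_0_infty_spec; exists d, M; split; [exact Hd |].
    intros u v Hu Hv; destruct (H1 u v Hu Hv) as [I [HI1 HI2]].
    exists I; split; [exact HI1 | apply HP, HI2].
Qed.

Lemma ImpInt_unique {V : CompleteNormedModule R_AbsRing} (f : R -> V) (l l' : V) :
  ImpInt f l -> ImpInt f l' -> l = l'.
Proof.
  intros H H'; apply is_RInt_gen_unique in H; apply is_RInt_gen_unique in H'.
  congruence.
Qed.

Lemma ImpInt_ext {V : NormedModule R_AbsRing} (f g : R -> V) (l : V) :
  (forall t, 0 < t -> f t = g t) -> ImpInt f l -> ImpInt g l.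
Proof.
  intros H; apply is_RInt_gen_ext; apply at_right_0_infty_spec.
  exists 1, 1; split; [lra |]; cbn; intros u v Hu Hv t Ht; apply H.
  rewrite Rmin_left in Ht; lra.
Qed.

Lemma ImpInt_norm_le {V : CompleteNormedModule R_AbsRing} (f : R -> V) (g : R -> R) lf lg :
  (forall t, 0 < t -> norm (f t) <= g t) -> ImpInt f lf -> ImpInt (V := R_NormedModule) g lg ->
  norm lf <= lg.
Proof.
  intros H; apply RInt_gen_norm; apply at_right_0_infty_spec; exists 1, 1;
    (split; [lra |]); cbn; intros; [lra | apply H; lra].
Qed.

Lemma ImpInt_R_le (f g : R -> R) lf lg :
  (forall t, 0 < t -> f t <= g t) ->
  ImpInt (V := R_NormedModule) f lf -> ImpInt (V := R_NormedModule) g lg -> lf <= lg.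
Proof.
  intros H Hf Hg; apply Rnot_lt_le; intros Hlt.
  destruct (proj1 (ImpInt_spec _ _) Hf ((lf - lg) / 2)) as (d & M & Hd & H1); [lra |].
  destruct (proj1 (ImpInt_spec _ _) Hg ((lf - lg) / 2)) as (d' & M' & Hd' & H2); [lra |].
  set (u := Rmin (Rmin d d') 1 / 2); set (v := Rmax (Rmax M M') 1 + 1).
  assert (Hu : 0 < u < d /\ u < d' /\ u < 1).
  { unfold u, Rmin; repeat destruct Rle_dec; lra. }
  assert (Hv : M < v /\ M' < v /\ 1 < v).
  { unfold v, Rmax; repeat destruct Rle_dec; lra. }
  destruct (H1 u v) as (I & HI1 & HI2); try lra.
  destruct (H2 u v) as (J & HJ1 & HJ2); try lra.
  assert (I <= J).
  { apply (is_RInt_le f g u v); try assumption; [lra |]; intros; apply H; lra. }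
  change (Rabs (I - lf) < (lf - lg) / 2) in HI2.
  change (Rabs (J - lg) < (lf - lg) / 2) in HJ2.
  apply Rabs_def2 in HI2; apply Rabs_def2 in HJ2; lra.
Qed.

(** Enlarging the interval only increases the integral of a nonnegative function. *)
Lemma is_RInt_le_ImpInt (g : R -> R) G :
  (forall t, 0 < t -> 0 <= g t) -> ImpInt (V := R_NormedModule) g G ->
  forall u v I, 0 < u <= v -> is_RInt (V := R_NormedModule) g u v I -> I <= G.
Proof.
  intros Hg HG u v I Huv HI; apply Rnot_lt_le; intros Hlt.
  destruct (proj1 (ImpInt_spec _ _) HG (I - G)) as (d & M & Hd & H1); [lra |].
  set (u' := Rmin d u / 2); set (v' := Rmax M v + 1).
  assert (Hu : 0 < u' < d /\ u' < u).
  { unfold u', Rmin; destruct Rle_dec; lra. }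
  assert (Hv : M < v' /\ v < v').
  { unfold v', Rmax; destruct Rle_dec; lra. }
  destruct (H1 u' v') as (J & HJ1 & HJ2); try lra.
  assert (E1 : ex_RInt (V := R_CompleteNormedModule) g u' u).
  { apply (ex_RInt_Chasles_1 (V := R_CompleteNormedModule) g u' u v'); [lra |].
    exists J; exact HJ1. }
  assert (E2 : ex_RInt (V := R_CompleteNormedModule) g v v').
  { apply (ex_RInt_Chasles_2 (V := R_CompleteNormedModule) g u' v v'); [lra |].
    exists J; exact HJ1. }
  destruct E1 as [J1 E1]; destruct E2 as [J2 E2].
  pose proof (is_RInt_Chasles _ _ _ _ _ _ (is_RInt_Chasles _ _ _ _ _ _ E1 HI) E2) as E.
  apply (is_RInt_unique (V := R_CompleteNormedModule)) in E.
  apply (is_RInt_unique (V := R_CompleteNormedModule)) in HJ1.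
  assert (0 <= J1).
  { apply (is_RInt_ge_0 g u' u); [lra | exact E1 |]; intros; apply Hg; lra. }
  assert (0 <= J2).
  { apply (is_RInt_ge_0 g v v'); [lra | exact E2 |]; intros; apply Hg; lra. }
  assert (J = J1 + I + J2) by (rewrite <- HJ1, E; reflexivity).
  change (Rabs (J - G) < I - G) in HJ2; apply Rabs_def2 in HJ2; lra.
Qed.

Lemma ImpInt_derive {V : CompleteNormedModule R_AbsRing} (H h : R -> V) (A B : V) :
  (forall t, 0 < t -> is_derive H t (h t)) ->
  (forall t, 0 < t -> continuous h t) ->
  filterlim H (at_right 0) (locally A) ->
  filterlim H (Rbar_locally p_infty) (locally B) ->
  ImpInt h (minus B A).
Proof.
  intros Hd Hc HA HB P HP.
  assert (L : filterlim (fun ab : R * R => minus (H (snd ab)) (H (fst ab)))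
     (filter_prod (at_right 0) (Rbar_locally p_infty)) (locally (minus B A))).
  { unfold minus; eapply filterlim_comp_2; [| | apply (filterlim_plus B (opp A))].
    - eapply filterlim_comp; [apply filterlim_snd | exact HB].
    - eapply filterlim_comp; [| apply (filterlim_opp A)].
      eapply filterlim_comp; [apply filterlim_fst | exact HA]. }
  specialize (L P HP); unfold filtermap in L; unfold filtermapi.
  assert (L2 : filter_prod (at_right 0) (Rbar_locally p_infty)
    (fun ab => 0 < fst ab /\ fst ab <= snd ab)).
  { apply at_right_0_infty_spec; exists 1, 1; split; [lra |]; cbn; intros; lra. }
  generalize (filter_and _ _ L L2); apply filter_imp.
  intros [u v] [H1 [H2 H3]]; cbn in *.
  eexists; split; [| exact H1].
  apply is_RInt_derive; intros x Hx; rewrite Rmin_left in Hx by lra;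
    [apply Hd | apply Hc]; lra.
Qed.

Lemma plus_plus_opp {G : AbelianGroup} (x y : G) : plus (plus x y) (opp x) = y.
Proof. rewrite (plus_comm x), <- plus_assoc, plus_opp_r; apply plus_zero_r. Qed.

Lemma minus_minus_cancel {G : AbelianGroup} (x y w : G) :
  minus (minus x w) (minus y w) = minus x y.
Proof.
  unfold minus at 1; rewrite opp_minus; symmetry; apply minus_trans.
Qed.

Lemma norm_minus_le {K : AbsRing} {V : NormedModule K} (x y : V) :
  norm (minus x y) <= norm x + norm y.
Proof. rewrite <- (norm_opp y); apply norm_triangle. Qed.

(** Cauchy criterion: two integrals over large intervals are both compared with the
    integral over the intersection of these intervals, and the differences are
    controlled by the integrals of the majorant over the end pieces. *)
Lemma ImpInt_dominated {V : CompleteNormedModule R_AbsRing} (f : R -> V) (g : R -> R) G :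
  (forall u v, 0 < u <= v -> ex_RInt f u v) ->
  (forall t, 0 < t -> norm (f t) <= g t) ->
  ImpInt (V := R_NormedModule) g G ->
  exists l, ImpInt f l.
Proof.
  intros Hf Hle HG.
  assert (L : exists l, filterlim (fun ab => RInt f (fst ab) (snd ab))
     (filter_prod (at_right 0) (Rbar_locally p_infty)) (locally l)).
  { apply (filterlim_locally_cauchy (F := filter_prod (at_right 0) (Rbar_locally p_infty))).
    intros eps.
    destruct (proj1 (ImpInt_spec _ _) HG (eps / 4)) as (d & M & Hd & H1).
    { pose proof (cond_pos eps); lra. }
    exists (fun ab => 0 < fst ab < Rmin d 1 /\ Rmax M 1 < snd ab); split.
    { apply at_right_0_infty_spec; exists (Rmin d 1), (Rmax M 1); split;
        [unfold Rmin; destruct Rle_dec; lra | cbn; tauto]. }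
    assert (HH : forall u v u' v', 0 < u <= u' -> u' < Rmin d 1 -> Rmax M 1 < v' <= v ->
      norm (minus (RInt f u v) (RInt f u' v')) < eps / 2).
    { intros u v u' v' Hu Hu' Hv.
      pose proof (Rmin_l d 1); pose proof (Rmin_r d 1).
      pose proof (Rmax_l M 1); pose proof (Rmax_r M 1).
      destruct (H1 u v) as (I & HI1 & HI2); try lra.
      destruct (H1 u' v') as (J & HJ1 & HJ2); try lra.
      assert (E1 : ex_RInt (V := R_CompleteNormedModule) g u u').
      { apply (ex_RInt_Chasles_1 (V := R_CompleteNormedModule) g u u' v); [lra |].
        exists I; exact HI1. }
      assert (E2 : ex_RInt (V := R_CompleteNormedModule) g v' v).
      { apply (ex_RInt_Chasles_2 (V := R_CompleteNormedModule) g u v' v); [lra |].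
        exists I; exact HI1. }
      destruct E1 as [J1 E1]; destruct E2 as [J2 E2].
      pose proof (is_RInt_Chasles _ _ _ _ _ _ (is_RInt_Chasles _ _ _ _ _ _ E1 HJ1) E2) as E.
      apply (is_RInt_unique (V := R_CompleteNormedModule)) in E.
      apply (is_RInt_unique (V := R_CompleteNormedModule)) in HI1.
      assert (EI : I = J1 + J + J2) by (rewrite <- HI1, E; reflexivity).
      assert (N1 : norm (RInt f u u') <= J1).
      { apply (norm_RInt_le f g u u'); [lra | | | exact E1].
        - intros; apply Hle; lra.
        - apply (RInt_correct (V := V)), Hf; lra. }
      assert (N2 : norm (RInt f v' v) <= J2).
      { apply (norm_RInt_le f g v' v); [lra | | | exact E2].
        - intros; apply Hle; lra.
        - apply (RInt_correct (V := V)), Hf; lra. }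
      assert (EV : minus (RInt f u v) (RInt f u' v') = plus (RInt f u u') (RInt f v' v)).
      { rewrite <- (RInt_Chasles f u u' v), <- (RInt_Chasles f u' v' v); try (apply Hf; lra).
        unfold minus; rewrite <- plus_assoc; f_equal.
        exact (plus_plus_opp (G := V) _ _). }
      rewrite EV; eapply Rle_lt_trans; [apply (norm_triangle (V := V)) |].
      change (Rabs (I - G) < eps / 4) in HI2; change (Rabs (J - G) < eps / 4) in HJ2.
      apply Rabs_def2 in HI2; apply Rabs_def2 in HJ2; lra. }
    intros [u v] [u' v'] [Hu Hv] [Hu' Hv']; cbn in *.
    apply (norm_compat1 (V := V)).
    set (x := Rmax u u'); set (y := Rmin v v').
    assert (Hx : u <= x /\ u' <= x /\ x < Rmin d 1) by (unfold x, Rmax; destruct Rle_dec; lra).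
    assert (Hy : y <= v /\ y <= v' /\ Rmax M 1 < y)
      by (unfold y; unfold Rmin at 1 2 3; destruct Rle_dec; lra).
    pose proof (HH u v x y ltac:(lra) ltac:(lra) ltac:(lra)) as A1.
    pose proof (HH u' v' x y ltac:(lra) ltac:(lra) ltac:(lra)) as A2.
    eapply Rle_lt_trans; [right; apply (f_equal norm); symmetry;
      exact (minus_minus_cancel (G := V) _ _ (RInt f x y)) |].
    eapply Rle_lt_trans; [apply (norm_minus_le (V := V)) | lra]. }
  destruct L as [l L]; exists l; intros P HP.
  specialize (L P HP); unfold filtermap in L; unfold filtermapi.
  assert (L2 : filter_prod (at_right 0) (Rbar_locally p_infty)
    (fun ab => 0 < fst ab /\ fst ab <= snd ab)).
  { apply at_right_0_infty_spec; exists 1, 1; split; [lra |]; cbn; intros; lra. }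
  generalize (filter_and _ _ L L2); apply filter_imp.
  intros [u v] [H1 [H2 H3]]; cbn in *.
  eexists; split; [| exact H1].
  apply (RInt_correct (V := V)), Hf; lra.
Qed.

Lemma is_RInt_Cmult (f : R -> C) (c : C) u v (I : C) :
  is_RInt (V := C_R_NormedModule) f u v I ->
  is_RInt (V := C_R_NormedModule) (fun t => (c * f t)%C) u v (c * I)%C.
Proof.
  intros H.
  pose proof (is_RInt_fct_extend_fst _ _ _ _ H) as H1.
  pose proof (is_RInt_fct_extend_snd _ _ _ _ H) as H2.
  destruct c as [c1 c2]; destruct I as [I1 I2].
  apply (is_RInt_fct_extend_pair (U := R_NormedModule) (V := R_NormedModule)); cbn in *.
  - apply (is_RInt_minus (V := R_NormedModule));
      apply (is_RInt_scal (V := R_NormedModule)); assumption.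
  - apply (is_RInt_plus (V := R_NormedModule));
      apply (is_RInt_scal (V := R_NormedModule)); assumption.
Qed.

Lemma is_RInt_RtoC (f : R -> R) u v I :
  is_RInt (V := R_NormedModule) f u v I ->
  is_RInt (V := C_R_NormedModule) (fun t => RtoC (f t)) u v (RtoC I).
Proof.
  intros H.
  apply (is_RInt_fct_extend_pair (U := R_NormedModule) (V := R_NormedModule)); cbn.
  - exact H.
  - pose proof (is_RInt_const (V := R_NormedModule) u v 0) as H0.
    change (scal (v - u) 0) with ((v - u) * 0) in H0; rewrite Rmult_0_r in H0; exact H0.
Qed.

Lemma ImpInt_Cmult (f : R -> C) (c l : C) :
  ImpInt (V := C_R_NormedModule) f l ->
  ImpInt (V := C_R_NormedModule) (fun t => (c * f t)%C) (c * l)%C.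
Proof.
  intros H; apply ImpInt_spec; intros eps He.
  pose proof (Cmod_ge_0 c) as Hc.
  destruct (proj1 (ImpInt_spec _ _) H (eps / (Cmod c + 1))) as (d & M & Hd & H1).
  { apply Rdiv_lt_0_compat; lra. }
  exists d, M; split; [exact Hd |]; intros u v Hu Hv.
  destruct (H1 u v Hu Hv) as (I & HI1 & HI2).
  exists (c * I)%C; split; [apply is_RInt_Cmult, HI1 |].
  rewrite norm_Cmod in *; change (Cmod (I - l)%C < eps / (Cmod c + 1)) in HI2.
  change (Cmod (c * I - c * l)%C < eps).
  replace (c * I - c * l)%C with (c * (I - l))%C by ring; rewrite Cmod_mult.
  apply Rle_lt_trans with ((Cmod c + 1) * Cmod (I - l)%C).
  - apply Rmult_le_compat_r; [apply Cmod_ge_0 | lra].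
  - apply Rmult_lt_compat_l with (r := Cmod c + 1) in HI2; [| lra].
    replace ((Cmod c + 1) * (eps / (Cmod c + 1))) with eps in HI2 by (field; lra).
    exact HI2.
Qed.

Lemma ImpInt_RtoC (f : R -> R) (l : R) :
  ImpInt (V := R_NormedModule) f l ->
  ImpInt (V := C_R_NormedModule) (fun t => RtoC (f t)) (RtoC l).
Proof.
  intros H; apply ImpInt_spec; intros eps He.
  destruct (proj1 (ImpInt_spec _ _) H eps He) as (d & M & Hd & H1).
  exists d, M; split; [exact Hd |]; intros u v Hu Hv.
  destruct (H1 u v Hu Hv) as (I & HI1 & HI2).
  exists (RtoC I); split; [apply is_RInt_RtoC, HI1 |].
  rewrite norm_Cmod; change (Cmod (RtoC I - RtoC l)%C < eps).
  rewrite <- RtoC_minus, Cmod_R; exact HI2.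
Qed.

Lemma ImpInt_sum_n {V : CompleteNormedModule R_AbsRing} (h : nat -> R -> V) (l : nat -> V) n :
  (forall k, ImpInt (h k) (l k)) ->
  ImpInt (fun t => sum_n (fun k => h k t) n) (sum_n l n).
Proof.
  intros H; induction n as [| n IH].
  - rewrite sum_O; apply ImpInt_ext with (h O); [| apply H].
    intros; rewrite sum_O; reflexivity.
  - rewrite sum_Sn.
    apply ImpInt_ext with (fun t => plus (sum_n (fun k => h k t) n) (h (S n) t)).
    + intros; rewrite sum_Sn; reflexivity.
    + apply (is_RInt_gen_plus (V := V)); [exact IH | apply H].
Qed.

Lemma is_RInt_sum_n {V : NormedModule R_AbsRing} (h : nat -> R -> V) (l : nat -> V) u v n :
  (forall k, is_RInt (h k) u v (l k)) ->
  is_RInt (fun t => sum_n (fun k => h k t) n) u v (sum_n l n).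
Proof.
  intros H; induction n as [| n IH].
  - rewrite sum_O; apply is_RInt_ext with (h O); [| apply H].
    intros; rewrite sum_O; reflexivity.
  - rewrite sum_Sn.
    apply is_RInt_ext with (fun t => plus (sum_n (fun k => h k t) n) (h (S n) t)).
    + intros; rewrite sum_Sn; reflexivity.
    + apply is_RInt_plus; [exact IH | apply H].
Qed.

(** * Termwise integration of series *)

(** Only the terms beyond the index n have to be dominated, so that one majorant
    serves a family of series whose first terms are not controlled uniformly. *)
Lemma series_tail_le (a : nat -> C) (A : C) (M : nat -> R) m n :
  is_series (V := C_R_NormedModule) a A -> is_series M m ->
  (forall k, 0 <= M k) -> (forall k, (n < k)%nat -> Cmod (a k) <= M k) ->
  Cmod (A - sum_n (G := C_R_NormedModule) a n)%C <= m - sum_n M n.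
Proof.
  intros Ha HM HM0 Hle.
  assert (H : forall p, Cmod (sum_n (G := C_R_NormedModule) a (n + p)
      - sum_n (G := C_R_NormedModule) a n)%C <= sum_n M (n + p) - sum_n M n).
  { induction p as [| p IH].
    - rewrite Nat.add_0_r, Rminus_diag.
      replace (_ - _)%C with (RtoC 0) by ring; rewrite Cmod_0; lra.
    - rewrite Nat.add_succ_r, !sum_Sn.
      change (plus ?x ?y) with (x + y)%C at 1; change (plus ?x ?y) with (x + y)%R.
      replace (_ - _)%C with
        ((sum_n (G := C_R_NormedModule) a (n + p)
          - sum_n (G := C_R_NormedModule) a n) + a (S (n + p)))%C by (change plus with Cplus; ring).
      eapply Rle_trans; [apply Cmod_triangle |].
      specialize (Hle (S (n + p)) ltac:(lia)); lra. }
  assert (H2 : forall p, (n <= p)%nat -> Cmod (sum_n (G := C_R_NormedModule) a p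
      - sum_n (G := C_R_NormedModule) a n)%C <= m - sum_n M n).
  { intros p Hp; replace p with (n + (p - n))%nat by lia.
    eapply Rle_trans; [apply H |].
    enough (sum_n M (n + (p - n)) <= m) by lra.
    apply (is_lim_seq_incr_compare (sum_n M) m); [exact HM |].
    intros q; rewrite sum_Sn; change plus with Rplus.
    specialize (HM0 (S q)); lra. }
  apply Rnot_lt_le; intros Hlt.
  destruct (proj1 (filterlim_C eventually _ _) Ha
    (Cmod (A - sum_n (G := C_R_NormedModule) a n)%C - (m - sum_n M n)) ltac:(lra)) as [N HN].
  specialize (HN (max N n) ltac:(lia)); specialize (H2 (max N n) ltac:(lia)).
  set (s := sum_n (G := C_R_NormedModule) a (Nat.max N n)) in *.
  set (s0 := sum_n (G := C_R_NormedModule) a n) in *.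
  assert (E : Cmod (A - s0)%C <= Cmod (s - A)%C + Cmod (s - s0)%C).
  { rewrite <- (Cmod_opp (s - A)%C).
    replace (A - s0)%C with (- (s - A) + (s - s0))%C by ring; apply Cmod_triangle. }
  lra.
Qed.

Lemma series_tail_small (M : nat -> R) m eps :
  is_series M m -> 0 < eps -> exists N, forall n, (N <= n)%nat -> m - sum_n M n < eps.
Proof.
  intros H He.
  destruct (proj1 (filterlim_locally (sum_n M) m) H (mkposreal eps He)) as [N HN].
  exists N; intros n Hn; specialize (HN n Hn).
  change (Rabs (sum_n M n - m) < eps) in HN; apply Rabs_def2 in HN; lra.
Qed.

Section Interchange.

Variables (h : nat -> R -> C) (g : nat -> R -> R) (l : nat -> C) (G : nat -> R).
Variables (F : R -> C) (L : C).
Hypothesis Hh : forall k, ImpInt (V := C_R_NormedModule) (h k) (l k).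
Hypothesis Hhc : forall k u v, 0 < u <= v -> ex_RInt (V := C_R_NormedModule) (h k) u v.
Hypothesis Hgc : forall k u v, 0 < u <= v -> ex_RInt (V := R_NormedModule) (g k) u v.
Hypothesis Hle : forall k t, 0 < t -> Cmod (h k t) <= g k t.
Hypothesis Hg : forall k, ImpInt (V := R_NormedModule) (g k) (G k).
Hypothesis HG : ex_series G.
Hypothesis HM : forall u v, 0 < u <= v -> exists M, ex_series M /\
  forall k t, u <= t <= v -> Cmod (h k t) <= M k.
Hypothesis HF : forall t, 0 < t -> is_series (V := C_R_NormedModule) (fun k => h k t) (F t).
Hypothesis HL : is_series (V := C_R_NormedModule) l L.

Lemma majorant_integral_pos k : 0 <= G k.
Proof.
  apply Rle_trans with (norm (V := C_R_NormedModule) (l k)); [apply norm_ge_0 |].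
  apply (ImpInt_norm_le (V := C_R_CompleteNormedModule) (h k) (g k)); [| apply Hh | apply Hg].
  intros t Ht; rewrite norm_Cmod; apply Hle, Ht.
Qed.

(** On a compact interval the partial sums converge uniformly by the M-test, so the
    sum is integrable; the integrals of the majorants over (0, +oo) bound the remainder
    independently of the interval. *)
Lemma ImpInt_series_compact u v n : 0 < u <= v ->
  exists I J, is_RInt (V := C_R_NormedModule) F u v I
    /\ is_RInt (V := C_R_NormedModule)
         (fun t => sum_n (G := C_R_NormedModule) (fun k => h k t) n) u v J
    /\ Cmod (I - J)%C <= Series G - sum_n G n.
Proof.
  intros Huv.
  destruct (HM u v Huv) as (M & [m Hm] & HM').
  (* Convergence is uniform on all of R once the argument is projected onto [u, v]. *)
  set (clamp := fun t => Rmax u (Rmin t v)).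
  assert (Hcl : forall t, u <= clamp t <= v).
  { intros t; unfold clamp, Rmax, Rmin; repeat destruct Rle_dec; lra. }
  assert (Hcl2 : forall t, u < t < v -> clamp t = t).
  { intros t Ht; unfold clamp; rewrite Rmin_left, Rmax_right; lra. }
  set (I := fun k => RInt (V := C_R_CompleteNormedModule) (h k) u v).
  assert (HI : forall k, is_RInt (V := C_R_NormedModule) (h k) u v (I k)).
  { intros k; apply (RInt_correct (V := C_R_CompleteNormedModule)), Hhc, Huv. }
  destruct (filterlim_RInt (V := C_R_CompleteNormedModule)
    (fun n t => sum_n (G := C_R_NormedModule) (fun k => h k (clamp t)) n) u v eventually _
    (fun t => F (clamp t)) (sum_n (G := C_R_NormedModule) I)) as (If & HIf1 & HIf2).
  - intros p; apply (is_RInt_sum_n (V := C_R_NormedModule)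
      (fun k t => h k (clamp t))).
    intros k; apply (is_RInt_ext (V := C_R_NormedModule)) with (h k); [| apply HI].
    rewrite Rmin_left, Rmax_right by lra; intros t Ht; rewrite Hcl2 by exact Ht; reflexivity.
  - apply (filterlim_locally (U := fct_UniformSpace R C_R_CompleteNormedModule)); intros eps.
    destruct (series_tail_small M m eps Hm (cond_pos eps)) as [N HN].
    exists N; intros p Hp t.
    apply (norm_compat1 (V := C_R_NormedModule)); rewrite norm_Cmod.
    rewrite <- Cmod_opp.
    eapply Rle_lt_trans; [| apply (HN p Hp)].
    replace (- _)%C with (F (clamp t) -
       sum_n (G := C_R_NormedModule) (fun k => h k (clamp t)) p)%C.
    2:{ unfold minus; cbn; unfold Cminus, Copp, Cplus; cbn; f_equal; ring. }
    apply (series_tail_le (fun k => h k (clamp t))); [apply HF | exact Hm | |].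
    + specialize (Hcl t); lra.
    + intros k; eapply Rle_trans; [apply Cmod_ge_0 | apply (HM' k u); lra].
    + intros k _; apply HM', Hcl.
  - exists If, (sum_n (G := C_R_NormedModule) I n); repeat split.
    + apply (is_RInt_ext (V := C_R_NormedModule)) with (2 := HIf2).
      rewrite Rmin_left, Rmax_right by lra; intros t Ht; rewrite Hcl2 by exact Ht; reflexivity.
    + apply (is_RInt_sum_n (V := C_R_NormedModule) h), HI.
    + apply (series_tail_le I); [exact HIf1 | apply Series_correct, HG | exact majorant_integral_pos |].
      intros k _; destruct (Hgc k u v Huv) as [J HJ].
      apply Rle_trans with J.
      * rewrite <- norm_Cmod.
        apply (norm_RInt_le (V := C_R_NormedModule) (h k) (g k) u v); [lra | | apply HI | exact HJ].
        intros x Hx; rewrite norm_Cmod; apply Hle; lra.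
      * apply (is_RInt_le_ImpInt (g k) (G k)) with u v; try assumption; [| apply Hg].
        intros t Ht; eapply Rle_trans; [apply Cmod_ge_0 | apply Hle, Ht].
Qed.

(** Up to an error below epsilon / 3, uniform in the interval, both the integral of the
    sum and the sum of the integrals are replaced by finitely many terms. *)
Lemma ImpInt_series : ImpInt (V := C_R_NormedModule) F L.
Proof.
  apply ImpInt_spec; intros eps He.
  destruct (series_tail_small G (Series G) (eps / 3)) as [n Hn];
    [apply Series_correct, HG | lra |].
  specialize (Hn n (le_n _)).
  destruct (proj1 (ImpInt_spec _ _) (ImpInt_sum_n (V := C_R_CompleteNormedModule) h l n Hh) (eps / 3))
    as (d & M & Hd & H1); [lra |].
  exists (Rmin d 1), (Rmax M 1); split; [unfold Rmin; destruct Rle_dec; lra |].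
  intros u v Hu Hv.
  pose proof (Rmin_l d 1); pose proof (Rmin_r d 1).
  pose proof (Rmax_l M 1); pose proof (Rmax_r M 1).
  destruct (ImpInt_series_compact u v n) as (I & J & HI & HJ & HIJ); [lra |].
  exists I; split; [exact HI |].
  destruct (H1 u v) as (J' & HJ' & HJl); [lra | lra |].
  apply (is_RInt_unique (V := C_R_CompleteNormedModule)) in HJ.
  apply (is_RInt_unique (V := C_R_CompleteNormedModule)) in HJ'.
  assert (E : J' = J) by (rewrite <- HJ, <- HJ'; reflexivity).
  rewrite E in HJl; clear E HJ HJ'.
  rewrite norm_Cmod in *.
  change (Cmod (J - sum_n (G := C_R_NormedModule) l n)%C < eps / 3) in HJl.
  change (Cmod (I - L)%C < eps).
  assert (T : Cmod (L - sum_n (G := C_R_NormedModule) l n)%C <= Series G - sum_n G n).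
  { apply series_tail_le; [exact HL | apply Series_correct, HG | exact majorant_integral_pos |].
    intros k _; rewrite <- norm_Cmod.
    apply (ImpInt_norm_le (V := C_R_CompleteNormedModule) (h k) (g k)); [| apply Hh | apply Hg].
    intros t Ht; rewrite norm_Cmod; apply Hle, Ht. }
  set (s := sum_n (G := C_R_NormedModule) l n) in *.
  replace (I - L)%C with ((I - J) + ((J - s) + - (L - s)))%C by ring.
  eapply Rle_lt_trans; [apply Cmod_triangle |].
  pose proof (Cmod_triangle (J - s)%C (- (L - s))%C) as H4.
  rewrite Cmod_opp in H4; lra.
Qed.

End Interchange.

(** * Complex exponential and powers of a positive base *)

Lemma C_eq (z w : C) : Re z = Re w -> Im z = Im w -> z = w.
Proof. destruct z, w; cbn; intros; subst; reflexivity. Qed.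

Lemma Re_plus (z w : C) : Re (z + w)%C = Re z + Re w. Proof. reflexivity. Qed.
Lemma Im_plus (z w : C) : Im (z + w)%C = Im z + Im w. Proof. reflexivity. Qed.
Lemma Re_minus (z w : C) : Re (z - w)%C = Re z - Re w. Proof. reflexivity. Qed.
Lemma Re_mult_R (z : C) (r : R) : Re (z * RtoC r)%C = Re z * r.
Proof. destruct z; cbn; ring. Qed.
Lemma Im_mult_R (z : C) (r : R) : Im (z * RtoC r)%C = Im z * r.
Proof. destruct z; cbn; ring. Qed.

Lemma Cexp_plus (z w : C) : Cexp (z + w)%C = (Cexp z * Cexp w)%C.
Proof.
  destruct z, w; apply C_eq; unfold Cexp; cbn; rewrite exp_plus, ?cos_plus, ?sin_plus; ring.
Qed.

Lemma Cexp_RtoC (x : R) : Cexp (RtoC x) = RtoC (exp x).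
Proof. apply C_eq; unfold Cexp; cbn; rewrite ?cos_0, ?sin_0; ring. Qed.

Lemma Cexp_0 : Cexp 0 = 1.
Proof. rewrite Cexp_RtoC, exp_0; reflexivity. Qed.

Lemma Cmod_Cexp (z : C) : Cmod (Cexp z) = exp (Re z).
Proof.
  unfold Cexp, Cmod; cbn.
  replace (_ + _) with (exp (Re z) * exp (Re z)).
  - apply sqrt_square, Rlt_le, exp_pos.
  - transitivity (exp (Re z) * exp (Re z) * (Rsqr (sin (Im z)) + Rsqr (cos (Im z)))).
    + rewrite sin2_cos2; ring.
    + unfold Rsqr; ring.
Qed.

Lemma Rcpow_plus t (s w : C) : Rcpow t (s + w)%C = (Rcpow t s * Rcpow t w)%C.
Proof. unfold Rcpow; rewrite <- Cexp_plus; f_equal; ring. Qed.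

Lemma Rcpow_RtoC t x : Rcpow t (RtoC x) = RtoC (Rpower t x).
Proof. unfold Rcpow, Rpower; rewrite <- RtoC_mult; apply Cexp_RtoC. Qed.

Lemma Rcpow_0 t : Rcpow t 0 = 1.
Proof. unfold Rcpow; rewrite Cmult_0_l; apply Cexp_0. Qed.

Lemma Rcpow_1 t : 0 < t -> Rcpow t 1 = RtoC t.
Proof. intros Ht; rewrite Rcpow_RtoC, Rpower_1; auto. Qed.

Lemma Rcpow_succ t (s : C) : 0 < t -> Rcpow t (s + 1)%C = (Rcpow t s * RtoC t)%C.
Proof. intros Ht; rewrite Rcpow_plus, Rcpow_1; auto. Qed.

Lemma Rcpow_mult_base t u (s : C) : 0 < t -> 0 < u ->
  Rcpow (t * u) s = (Rcpow t s * Rcpow u s)%C.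
Proof.
  intros Ht Hu; unfold Rcpow; rewrite ln_mult, RtoC_plus by assumption.
  rewrite <- Cexp_plus; f_equal; ring.
Qed.

Lemma Rcpow_pow t (s : C) k : (Rcpow t s ^ k)%C = Rcpow t (s * RtoC (INR k))%C.
Proof.
  induction k as [| k IH].
  - cbn [INR]; rewrite Cmult_0_r, Rcpow_0; reflexivity.
  - cbn [Cpow]; rewrite IH, S_INR, <- Rcpow_plus, RtoC_plus; f_equal; ring.
Qed.

Lemma Cmod_Rcpow t (s : C) : Cmod (Rcpow t s) = Rpower t (Re s).
Proof. unfold Rcpow, Rpower; rewrite Cmod_Cexp, Re_mult_R; reflexivity. Qed.

Lemma Rpower_pos t x : 0 < Rpower t x.
Proof. apply exp_pos. Qed.

Lemma Rcpow_neq_0 t (s : C) : Rcpow t s <> 0.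
Proof. apply Cmod_gt_0; rewrite Cmod_Rcpow; apply Rpower_pos. Qed.

Lemma is_derive_pair (f1 f2 : R -> R) t d1 d2 :
  is_derive f1 t d1 -> is_derive f2 t d2 ->
  is_derive (K := R_AbsRing) (V := C_R_NormedModule) (fun x => (f1 x, f2 x) : C) t (d1, d2).
Proof.
  intros H1 H2.
  apply (is_derive_ext (K := R_AbsRing) (V := C_R_NormedModule)
    (fun x => plus (scal (f1 x) ((1, 0) : C_R_NormedModule)) (scal (f2 x) ((0, 1) : C_R_NormedModule)))).
  { intros x; apply C_eq; cbn; unfold scal, plus; cbn; unfold mult; cbn; ring. }
  replace ((d1, d2) : C) with
    (plus (scal d1 ((1, 0) : C_R_NormedModule)) (scal d2 ((0, 1) : C_R_NormedModule)))
    by (apply C_eq; cbn; unfold scal, plus; cbn; unfold mult; cbn; ring).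
  apply (is_derive_plus (V := C_R_NormedModule));
    apply (is_derive_scal_l (V := C_R_NormedModule)); assumption.
Qed.

(** The derivative is integrated, since a complex-valued function has no mean value theorem. *)
Lemma C_mean_value (f df : R -> C) a b M :
  (forall t, Rmin a b <= t <= Rmax a b ->
    is_derive (K := R_AbsRing) (V := C_R_NormedModule) f t (df t)) ->
  (forall t, Rmin a b <= t <= Rmax a b ->
    continuous (T := R_UniformSpace) (U := C_R_NormedModule) df t) ->
  (forall t, Rmin a b <= t <= Rmax a b -> Cmod (df t) <= M) ->
  Cmod (f b - f a)%C <= M * Rabs (b - a).
Proof.
  intros Hd Hc HM.
  pose proof (is_RInt_derive (V := C_R_CompleteNormedModule) f df a b Hd Hc) as HI.
  change (minus (f b) (f a)) with (f b - f a)%C in HI.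
  assert (HC : is_RInt (V := R_NormedModule) (fun _ => M) a b (scal (b - a) M))
    by apply (is_RInt_const (V := R_NormedModule)).
  destruct (Rle_dec a b) as [Hab | Hab].
  - rewrite Rabs_pos_eq by lra; rewrite Rmult_comm, <- norm_Cmod.
    apply (norm_RInt_le (V := C_R_NormedModule) df (fun _ => M) a b); try assumption.
    intros x Hx; rewrite norm_Cmod; apply HM; rewrite Rmin_left, Rmax_right; lra.
  - apply (is_RInt_swap (V := C_R_NormedModule)) in HI.
    rewrite Rabs_left by lra; rewrite Rmult_comm, <- Cmod_opp, <- norm_Cmod.
    replace (- (b - a)) with (a - b) by ring.
    apply (norm_RInt_le (V := C_R_NormedModule) df (fun _ => M) b a); [lra | | exact HI |].
    + intros x Hx; rewrite norm_Cmod; apply HM; rewrite Rmin_right, Rmax_left; lra.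
    + apply (is_RInt_const (V := R_NormedModule)).
Qed.

Lemma is_derive_Cexp_line (w : C) t :
  is_derive (K := R_AbsRing) (V := C_R_NormedModule)
    (fun x => Cexp (w * RtoC x)%C) t (w * Cexp (w * RtoC t))%C.
Proof.
  destruct w as [x y].
  replace (((x, y) : C) * Cexp ((x, y) * RtoC t))%C with
    ((x * exp (x * t) * cos (y * t) - exp (x * t) * (y * sin (y * t)),
      x * exp (x * t) * sin (y * t) + exp (x * t) * (y * cos (y * t))) : C).
  2:{ unfold Cexp; apply C_eq; cbn;
      replace (x * t - y * 0) with (x * t) by ring;
      replace (x * 0 + y * t) with (y * t) by ring; ring. }
  eapply (is_derive_ext (K := R_AbsRing) (V := C_R_NormedModule)).
  2: apply (is_derive_pair (fun r => exp (x * r) * cos (y * r)) (fun r => exp (x * r) * sin (y * r))).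
  - intros r; unfold Cexp; apply C_eq; cbn;
      replace (x * r - y * 0) with (x * r) by ring;
      replace (x * 0 + y * r) with (y * r) by ring; reflexivity.
  - auto_derive; [exact I | ring].
  - auto_derive; [exact I | ring].
Qed.

(** Mean value inequality on the segment from 0 to w. *)
Lemma Cexp_minus_1_le (w : C) : Cmod (Cexp w - 1)%C <= Cmod w * (1 + exp (Re w)).
Proof.
  assert (Hd := is_derive_Cexp_line w).
  assert (H : Cmod (Cexp (w * RtoC 1) - Cexp (w * RtoC 0))%C
    <= Cmod w * (1 + exp (Re w)) * Rabs (1 - 0)).
  { apply (C_mean_value (fun x => Cexp (w * RtoC x)%C) (fun x => w * Cexp (w * RtoC x))%C).
    - intros; apply Hd.
    - intros t _.
      apply (continuous_ext (fun t => (w * Cexp (w * RtoC t))%C)); [reflexivity |].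
      apply (filterlim_C_mult (locally t)); [apply filterlim_const |].
      apply (ex_derive_continuous (K := R_AbsRing) (V := C_R_NormedModule)
        (fun x => Cexp (w * RtoC x)%C)); eexists; apply Hd.
    - rewrite Rmin_left, Rmax_right by lra; intros t Ht.
      rewrite Cmod_mult, Cmod_Cexp, Re_mult_R.
      apply Rmult_le_compat_l; [apply Cmod_ge_0 |].
      destruct (Rle_dec 0 (Re w)).
      + assert (exp (Re w * t) <= exp (Re w)); [| lra].
        destruct (Rle_lt_or_eq_dec (Re w * t) (Re w)); [nra | |].
        * apply Rlt_le, exp_increasing; assumption.
        * right; congruence.
      + pose proof (exp_pos (Re w)).
        assert (exp (Re w * t) <= exp 0); [| rewrite exp_0 in *; lra].
        destruct (Rle_lt_or_eq_dec (Re w * t) 0); [nra | |].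
        * apply Rlt_le, exp_increasing; assumption.
        * right; congruence. }
  rewrite Rminus_0_r, Rabs_R1, Rmult_1_r, Cmult_1_r, Cmult_0_r, Cexp_0 in H; exact H.
Qed.

Lemma exp_le x y : x <= y -> exp x <= exp y.
Proof.
  intros [H | H]; [apply Rlt_le, exp_increasing, H | right; congruence].
Qed.

Lemma is_derive_Rcpow t (s : C) : 0 < t ->
  is_derive (K := R_AbsRing) (V := C_R_NormedModule)
    (fun x => Rcpow x s) t (s * Rcpow t (s - 1))%C.
Proof.
  intros Ht.
  replace (s * Rcpow t (s - 1))%C with (scal (/ t) (s * Cexp (s * RtoC (ln t)))%C
    : C_R_NormedModule).
  - apply (is_derive_comp (V := C_R_NormedModule) (fun x => Cexp (s * RtoC x)%C) ln).
    + apply is_derive_Cexp_line.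
    + apply is_derive_ln; exact Ht.
  - assert (E : Rcpow t s = (Rcpow t (s - 1) * RtoC t)%C).
    { rewrite <- Rcpow_succ by exact Ht; f_equal; ring. }
    change (Cexp (s * RtoC (ln t))) with (Rcpow t s); rewrite E.
    rewrite (Cmult_assoc s); destruct (s * Rcpow t (s - 1))%C as [x y].
    apply C_eq; cbn; unfold scal; cbn; unfold mult; cbn; field; lra.
Qed.

Lemma continuous_Rcpow t (s : C) : 0 < t ->
  continuous (T := R_UniformSpace) (U := C_R_NormedModule) (fun x => Rcpow x s) t.
Proof.
  intros Ht; apply (ex_derive_continuous (K := R_AbsRing) (V := C_R_NormedModule)).
  eexists; apply is_derive_Rcpow, Ht.
Qed.

(** * Euler's integral for the Gamma function *)

Definition euler_kernel (s : C) (t : R) : C := (Rcpow t (s - 1) * RtoC (exp (- t)))%C.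

(** The modulus of the Euler kernel depends on the real part of s only. *)
Definition euler_kernelR (x t : R) : R := Rpower t (x - 1) * exp (- t).

Lemma euler_kernelR_pos x t : 0 < euler_kernelR x t.
Proof. apply Rmult_lt_0_compat; apply exp_pos. Qed.

Lemma Cmod_euler_kernel s t : Cmod (euler_kernel s t) = euler_kernelR (Re s) t.
Proof.
  unfold euler_kernel, euler_kernelR; rewrite Cmod_mult, Cmod_Rcpow, Cmod_R.
  rewrite Rabs_pos_eq by (apply Rlt_le, exp_pos); reflexivity.
Qed.

Lemma euler_kernel_RtoC x t : euler_kernel (RtoC x) t = RtoC (euler_kernelR x t).
Proof.
  unfold euler_kernel, euler_kernelR; rewrite <- RtoC_minus, Rcpow_RtoC, <- RtoC_mult; reflexivity.
Qed.

Lemma euler_kernel_succ s t : 0 < t -> euler_kernel (s + 1)%C t = (euler_kernel s t * RtoC t)%C.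
Proof.
  intros Ht; unfold euler_kernel.
  replace (s + 1 - 1)%C with ((s - 1) + 1)%C by ring.
  rewrite Rcpow_succ by exact Ht; ring.
Qed.

Lemma euler_kernelR_succ x t : 0 < t -> euler_kernelR (x + 1) t = euler_kernelR x t * t.
Proof.
  intros Ht; unfold euler_kernelR; replace (x + 1 - 1) with ((x - 1) + 1) by ring.
  rewrite Rpower_plus, Rpower_1 by exact Ht; ring.
Qed.

(** Integrated over (0, +oo), this identity is the functional equation of Gamma, because
    the kernel at s + 1 vanishes at both ends. *)
Lemma is_derive_euler_kernel s t : 0 < t ->
  is_derive (K := R_AbsRing) (V := C_R_NormedModule) (euler_kernel (s + 1)%C) t
    (s * euler_kernel s t - euler_kernel (s + 1)%C t)%C.
Proof.
  intros Ht.
  apply (is_derive_ext (K := R_AbsRing) (V := C_R_NormedModule)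
    (fun x => Cexp (s * RtoC (ln x) + - RtoC x)%C)).
  { intros x; unfold euler_kernel, Rcpow; replace (s + 1 - 1)%C with s by ring.
    rewrite Cexp_plus, <- RtoC_opp, Cexp_RtoC; reflexivity. }
  replace (s * euler_kernel s t - euler_kernel (s + 1) t)%C with
    ((s * RtoC (/ t) + - RtoC 1) * Cexp (s * RtoC (ln t) + - RtoC t))%C.
  2:{ rewrite euler_kernel_succ by exact Ht.
      rewrite Cexp_plus, <- (RtoC_opp t), Cexp_RtoC; fold (Rcpow t s).
      assert (E : Rcpow t s = (Rcpow t (s - 1) * RtoC t)%C).
      { rewrite <- Rcpow_succ by exact Ht; f_equal; ring. }
      rewrite E; unfold euler_kernel; rewrite RtoC_inv by lra.
      field; intros E0; apply RtoC_inj in E0; lra. }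
  destruct s as [x y].
  replace (((x, y) * RtoC (/ t) + - RtoC 1) * Cexp ((x, y) * RtoC (ln t) + - RtoC t))%C
    with ((exp (x * ln t - t) * (x / t - 1) * cos (y * ln t)
           - exp (x * ln t - t) * (y / t * sin (y * ln t)),
           exp (x * ln t - t) * (x / t - 1) * sin (y * ln t)
           + exp (x * ln t - t) * (y / t * cos (y * ln t))) : C).
  2:{ unfold Cexp; apply C_eq; cbn;
      replace (x * ln t - y * 0 + - t) with (x * ln t - t) by ring;
      replace (x * 0 + y * ln t + - 0) with (y * ln t) by ring; unfold Rdiv; ring. }
  eapply (is_derive_ext (K := R_AbsRing) (V := C_R_NormedModule)).
  2: apply (is_derive_pair (fun r => exp (x * ln r - r) * cos (y * ln r))
       (fun r => exp (x * ln r - r) * sin (y * ln r))).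
  - intros r; unfold Cexp; apply C_eq; cbn;
      replace (x * ln r - y * 0 + - r) with (x * ln r - r) by ring;
      replace (x * 0 + y * ln r + - 0) with (y * ln r) by ring; reflexivity.
  - auto_derive; [lra | unfold Rminus; field; lra].
  - auto_derive; [lra | unfold Rminus; field; lra].
Qed.

Lemma continuous_euler_kernel s t : 0 < t ->
  continuous (T := R_UniformSpace) (U := C_R_NormedModule) (euler_kernel s) t.
Proof.
  intros Ht; apply (ex_derive_continuous (K := R_AbsRing) (V := C_R_NormedModule)).
  replace s with (s - 1 + 1)%C by ring; eexists; apply is_derive_euler_kernel, Ht.
Qed.

Lemma continuous_euler_kernelR x t : 0 < t -> continuous (euler_kernelR x) t.
Proof.
  intros Ht; apply (ex_derive_continuous (K := R_AbsRing) (V := R_NormedModule)).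
  unfold euler_kernelR, Rpower; auto_derive; lra.
Qed.

Lemma ex_RInt_euler_kernel s u v : 0 < u <= v -> ex_RInt (V := C_R_NormedModule) (euler_kernel s) u v.
Proof.
  intros H; apply (ex_RInt_continuous (V := C_R_CompleteNormedModule)).
  rewrite Rmin_left by lra; intros; apply continuous_euler_kernel; lra.
Qed.

Lemma ex_RInt_euler_kernelR x u v : 0 < u <= v -> ex_RInt (V := R_NormedModule) (euler_kernelR x) u v.
Proof.
  intros H; apply (ex_RInt_continuous (V := R_CompleteNormedModule)).
  rewrite Rmin_left by lra; intros; apply continuous_euler_kernelR; lra.
Qed.

(** The inequality ln y <= y - 1 at y = t / (2 x). *)
Lemma Rpower_le_exp x t : 0 < x -> 0 < t ->
  Rpower t x <= exp (x * ln (2 * x)) * exp (t / 2).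
Proof.
  intros Hx Ht; unfold Rpower; rewrite <- exp_plus; apply exp_le.
  assert (H : t / (2 * x) >= ln (t / (2 * x)) + 1).
  { assert (0 < t / (2 * x)) by (apply Rdiv_lt_0_compat; lra).
    pose proof (exp_ineq1_le (ln (t / (2 * x)))) as H1; rewrite exp_ln in H1; lra. }
  unfold Rdiv in H at 2; rewrite ln_mult, ln_Rinv in H;
    [| lra | lra | apply Rinv_0_lt_compat; lra].
  assert (x * (t / (2 * x)) = t / 2) by (field; lra).
  nra.
Qed.

Lemma Rpower_small_at_0 x eps : 0 < x -> 0 < eps ->
  exists d, 0 < d /\ forall t, 0 < t < d -> Rpower t x < eps.
Proof.
  intros Hx He; exists (exp (ln eps / x)); split; [apply exp_pos |].
  intros t Ht; unfold Rpower; rewrite <- (exp_ln eps) by exact He.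
  apply exp_increasing.
  assert (ln t < ln eps / x).
  { rewrite <- (ln_exp (ln eps / x)); apply ln_increasing; lra. }
  apply Rmult_lt_compat_l with (r := x) in H; [| exact Hx].
  replace (x * (ln eps / x)) with (ln eps) in H by (field; lra); exact H.
Qed.

Lemma at_right_0_intro (P : R -> Prop) d : 0 < d -> (forall t, 0 < t < d -> P t) ->
  at_right 0 P.
Proof.
  intros Hd H; exists (mkposreal d Hd); intros t Ht Ht0; apply H; split; [exact Ht0 |].
  change (Rabs (t - 0) < d) in Ht; rewrite Rminus_0_r, Rabs_pos_eq in Ht; lra.
Qed.

Lemma euler_kernel_lim_0 s : 0 < Re s ->
  filterlim (euler_kernel (s + 1)%C) (at_right 0) (locally (T := C_R_NormedModule) (RtoC 0)).
Proof.
  intros Hs; apply filterlim_C; [apply _ |]; intros eps He.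
  destruct (Rpower_small_at_0 (Re s) eps Hs He) as (d & Hd & H).
  apply at_right_0_intro with d; [exact Hd |]; intros t Ht.
  replace (_ - _)%C with (euler_kernel (s + 1) t) by ring; rewrite Cmod_euler_kernel; unfold euler_kernelR.
  rewrite Re_plus; cbn [Re RtoC fst].
  replace (Re s + 1 - 1) with (Re s) by ring.
  apply Rle_lt_trans with (2 := H t Ht).
  rewrite <- (Rmult_1_r (Rpower t (Re s))) at 2.
  apply Rmult_le_compat_l; [apply Rlt_le, Rpower_pos |].
  rewrite <- exp_0; apply exp_le; lra.
Qed.

Lemma euler_kernel_lim_infty s : 0 < Re s ->
  filterlim (euler_kernel (s + 1)%C) (Rbar_locally p_infty) (locally (T := C_R_NormedModule) (RtoC 0)).
Proof.
  intros Hs; apply filterlim_C; [apply _ |]; intros eps He.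
  set (K := exp (Re s * ln (2 * Re s))).
  assert (HK : 0 < K) by apply exp_pos.
  exists (Rmax 0 (- 2 * ln (eps / K))); intros t Ht.
  pose proof (Rmax_l 0 (- 2 * ln (eps / K))); pose proof (Rmax_r 0 (- 2 * ln (eps / K))).
  replace (_ - _)%C with (euler_kernel (s + 1) t) by ring; rewrite Cmod_euler_kernel; unfold euler_kernelR.
  rewrite Re_plus; cbn [Re RtoC fst].
  replace (Re s + 1 - 1) with (Re s) by ring.
  apply Rle_lt_trans with (K * exp (t / 2) * exp (- t)).
  { apply Rmult_le_compat_r; [apply Rlt_le, exp_pos |].
    apply Rpower_le_exp; lra. }
  rewrite Rmult_assoc, <- exp_plus.
  replace (t / 2 + - t) with (- (t / 2)) by field.
  apply Rlt_le_trans with (K * (eps / K)); [| right; field; lra].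
  apply Rmult_lt_compat_l; [exact HK |].
  assert (0 < eps / K) by (apply Rdiv_lt_0_compat; lra).
  rewrite <- (exp_ln (eps / K)) by assumption; apply exp_increasing; lra.
Qed.

(** The kernel is dominated by a multiple of t^(x-1) / (1 + t^x)^2, whose primitive
    - 1 / (x (1 + t^x)) is bounded on (0, +oo). *)
Lemma ex_ImpInt_euler_kernelR x : 0 < x -> exists l, ImpInt (V := R_NormedModule) (euler_kernelR x) l.
Proof.
  intros Hx.
  set (K := exp (x * ln (2 * x))); assert (HK : 0 < K) by apply exp_pos.
  set (c := (1 + K) ^ 2).
  set (h := fun t => c * (Rpower t (x - 1) / (1 + Rpower t x) ^ 2)).
  set (H := fun t => - (c / x) * / (1 + Rpower t x)).
  assert (HH : ImpInt (V := R_NormedModule) h (minus 0 (- (c / x) * / (1 + 0)))).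
  { apply (ImpInt_derive (V := R_CompleteNormedModule) H h).
    - intros t Ht; unfold H, h, Rpower.
      assert (E : exp ((x - 1) * ln t) = exp (x * ln t) / t).
      { replace ((x - 1) * ln t) with (x * ln t + - ln t) by ring.
        rewrite exp_plus, exp_Ropp, exp_ln by exact Ht; reflexivity. }
      pose proof (exp_pos (x * ln t)).
      auto_derive; [repeat split; lra |].
      rewrite E; field; repeat split; lra.
    - intros t Ht; apply (ex_derive_continuous (K := R_AbsRing) (V := R_NormedModule)).
      unfold h, Rpower; pose proof (exp_pos (x * ln t)).
      auto_derive; repeat split; try lra.
      intros E; assert (0 < 1 + exp (x * ln t)) by lra.
      match type of E with ?a = 0 => assert (0 < a); [| lra] end.
      repeat apply Rmult_lt_0_compat; lra.
    - unfold H.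
      apply (filterlim_comp _ _ _ (fun t => Rpower t x) (fun y => - (c / x) * / (1 + y)) _ (locally 0)).
      + apply (filterlim_locally (U := R_UniformSpace)); intros eps.
        destruct (Rpower_small_at_0 x eps Hx (cond_pos eps)) as (d & Hd & Hs).
        apply at_right_0_intro with d; [exact Hd |]; intros t Ht.
        change (Rabs (Rpower t x - 0) < eps).
        rewrite Rminus_0_r, Rabs_pos_eq by apply Rlt_le, Rpower_pos; auto.
      + apply (ex_derive_continuous (K := R_AbsRing) (V := R_NormedModule)
          (fun y => - (c / x) * / (1 + y))); auto_derive; lra.
    - apply (filterlim_locally (U := R_UniformSpace)); intros eps.
      assert (Hc : 0 < c / x) by (apply Rdiv_lt_0_compat; [unfold c; nra | lra]).
      set (A := c / x / eps).
      assert (HA : 0 < A) by (apply Rdiv_lt_0_compat; [exact Hc | apply cond_pos]).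
      exists (Rmax 1 (exp (ln A / x))); intros t Ht.
      pose proof (Rmax_l 1 (exp (ln A / x))); pose proof (Rmax_r 1 (exp (ln A / x))).
      change (Rabs (H t - 0) < eps); unfold H.
      assert (A < Rpower t x).
      { unfold Rpower; rewrite <- (exp_ln A) by exact HA; apply exp_increasing.
        assert (H2 : ln A / x < ln t).
        { rewrite <- (ln_exp (ln A / x)); apply ln_increasing; [apply exp_pos | lra]. }
        apply Rmult_lt_compat_l with (r := x) in H2; [| exact Hx].
        replace (x * (ln A / x)) with (ln A) in H2 by (field; lra); exact H2. }
      rewrite Rminus_0_r, Rabs_mult, Rabs_Ropp, (Rabs_pos_eq (c / x)) by lra.
      rewrite Rabs_inv, Rabs_pos_eq by lra.
      pose proof (cond_pos eps).
      assert (E : c / x = eps * A) by (unfold A; field; repeat split; lra).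
      rewrite E; apply Rmult_lt_reg_r with (1 + Rpower t x); [lra |].
      rewrite Rmult_assoc, Rinv_l, Rmult_1_r by lra.
      apply Rmult_lt_compat_l; lra. }
  eapply (ImpInt_dominated (V := R_CompleteNormedModule) (euler_kernelR x) h); [| | exact HH].
  - apply ex_RInt_euler_kernelR.
  - intros t Ht; change (Rabs (euler_kernelR x t) <= h t).
    rewrite Rabs_pos_eq by apply Rlt_le, euler_kernelR_pos; unfold euler_kernelR, h.
    pose proof (Rpower_pos t x) as Hp; pose proof (Rpower_pos t (x - 1)) as Hp1.
    pose proof (Rpower_le_exp x t Hx Ht) as Hle; fold K in Hle.
    rewrite exp_Ropp.
    pose proof (exp_pos (t / 2)) as He.
    assert (E : exp t = exp (t / 2) * exp (t / 2)) by (rewrite <- exp_plus; f_equal; field).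
    assert (1 <= exp (t / 2)) by (rewrite <- exp_0; apply exp_le; lra).
    assert (H1 : (1 + Rpower t x) ^ 2 <= c * exp t).
    { rewrite E; unfold c; replace ((1 + K) ^ 2 * (exp (t / 2) * exp (t / 2)))
        with (((1 + K) * exp (t / 2)) ^ 2) by ring.
      apply pow_incr; split; [lra | nra]. }
    unfold Rdiv; rewrite <- Rmult_assoc, (Rmult_comm c), Rmult_assoc.
    apply Rmult_le_compat_l; [lra |].
    pose proof (exp_pos t).
    apply Rmult_le_reg_r with (exp t * (1 + Rpower t x) ^ 2).
    + apply Rmult_lt_0_compat; [lra | apply pow_lt; lra].
    + replace (/ exp t * (exp t * (1 + Rpower t x) ^ 2)) with ((1 + Rpower t x) ^ 2) by (field; lra).
      replace (c * / (1 + Rpower t x) ^ 2 * (exp t * (1 + Rpower t x) ^ 2))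
        with (c * exp t) by (field; lra).
      exact H1.
Qed.

Definition GammaR (x : R) : R :=
  RInt_gen (V := R_CompleteNormedModule) (euler_kernelR x) (at_right 0) (Rbar_locally p_infty).

(** Euler's integral; it is the Gamma function for Re s > 0. *)
Definition GammaC (s : C) : C := CInt_0_inf (euler_kernel s).

Lemma GammaR_correct x : 0 < x -> ImpInt (V := R_NormedModule) (euler_kernelR x) (GammaR x).
Proof.
  intros Hx; apply (RInt_gen_correct (V := R_CompleteNormedModule)).
  apply ex_ImpInt_euler_kernelR, Hx.
Qed.

Lemma GammaC_correct s : 0 < Re s -> ImpInt (V := C_R_NormedModule) (euler_kernel s) (GammaC s).
Proof.
  intros Hs; apply (RInt_gen_correct (V := C_R_CompleteNormedModule)).
  apply (ImpInt_dominated (V := C_R_CompleteNormedModule) (euler_kernel s) (euler_kernelR (Re s)) (GammaR (Re s))).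
  - apply ex_RInt_euler_kernel.
  - intros t Ht; right; rewrite <- Cmod_euler_kernel; apply norm_Cmod.
  - apply GammaR_correct, Hs.
Qed.

Lemma GammaC_RtoC x : 0 < x -> GammaC (RtoC x) = RtoC (GammaR x).
Proof.
  intros Hx; apply (ImpInt_unique (V := C_R_CompleteNormedModule) (euler_kernel (RtoC x))).
  - apply GammaC_correct, Hx.
  - apply ImpInt_ext with (fun t => RtoC (euler_kernelR x t)).
    + intros; symmetry; apply euler_kernel_RtoC.
    + apply ImpInt_RtoC, GammaR_correct, Hx.
Qed.

Lemma GammaC_succ s : 0 < Re s -> GammaC (s + 1)%C = (s * GammaC s)%C.
Proof.
  intros Hs.
  assert (H : ImpInt (V := C_R_NormedModule) (fun t => s * euler_kernel s t - euler_kernel (s + 1)%C t)%C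
     (minus (G := C_R_NormedModule) (RtoC 0) (RtoC 0))).
  { apply (ImpInt_derive (V := C_R_CompleteNormedModule) (euler_kernel (s + 1)%C)).
    - intros; apply is_derive_euler_kernel; assumption.
    - intros t Ht; apply (continuous_minus (V := C_R_NormedModule)
        (fun t => (s * euler_kernel s t)%C) (euler_kernel (s + 1)%C)).
      + apply (filterlim_C_mult (locally t)); [apply filterlim_const |].
        apply continuous_euler_kernel, Ht.
      + apply continuous_euler_kernel, Ht.
    - apply euler_kernel_lim_0, Hs.
    - apply euler_kernel_lim_infty, Hs. }
  assert (H2 : ImpInt (V := C_R_NormedModule) (fun t => s * euler_kernel s t - euler_kernel (s + 1)%C t)%C
     (minus (G := C_R_NormedModule) (s * GammaC s)%C (GammaC (s + 1)%C))).
  { apply (is_RInt_gen_minus (V := C_R_NormedModule) (fun t => (s * euler_kernel s t)%C) (euler_kernel (s + 1)%C)).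
    - apply ImpInt_Cmult, GammaC_correct, Hs.
    - apply GammaC_correct; rewrite Re_plus; cbn; lra. }
  pose proof (ImpInt_unique (V := C_R_CompleteNormedModule) _ _ _ H H2) as E.
  change (0 - 0 = s * GammaC s - GammaC (s + 1))%C in E.
  replace (GammaC (s + 1)) with (s * GammaC s - (s * GammaC s - GammaC (s + 1)))%C by ring.
  rewrite <- E; ring.
Qed.

Lemma GammaR_succ x : 0 < x -> GammaR (x + 1) = x * GammaR x.
Proof.
  intros Hx; apply RtoC_inj.
  rewrite RtoC_mult, <- !GammaC_RtoC, RtoC_plus by lra.
  apply GammaC_succ; exact Hx.
Qed.

Lemma GammaR_1 : GammaR 1 = 1.
Proof.
  apply (ImpInt_unique (V := R_CompleteNormedModule) (euler_kernelR 1));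
    [apply GammaR_correct; lra |].
  assert (H : ImpInt (V := R_NormedModule) (fun t => exp (- t)) 1).
  { replace 1 with (- 0 - - exp (- 0)) by (rewrite Ropp_0, exp_0; ring).
    apply (ImpInt_derive (V := R_CompleteNormedModule) (fun t => - exp (- t))).
    - intros t Ht; auto_derive; [exact I | ring].
    - intros t Ht; apply (ex_derive_continuous (K := R_AbsRing) (V := R_NormedModule)).
      auto_derive; exact I.
    - apply (filterlim_filter_le_1 (F := locally 0) (G := at_right 0) (fun t => - exp (- t)));
        [apply filter_le_within |].
      apply (ex_derive_continuous (K := R_AbsRing) (V := R_NormedModule) (fun t => - exp (- t))).
      auto_derive; exact I.
    - apply (is_lim_opp (fun t => exp (- t)) p_infty 0).
      apply (is_lim_comp exp Ropp p_infty 0 m_infty); [apply is_lim_exp_m | |].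
      + apply (is_lim_opp (fun t => t) p_infty p_infty), is_lim_id.
      + exists 0; discriminate. }
  apply ImpInt_ext with (2 := H).
  intros t Ht; unfold euler_kernelR; rewrite Rminus_diag, Rpower_O by exact Ht; rewrite Rmult_1_l; reflexivity.
Qed.

Lemma GammaR_fact n : GammaR (INR n + 1) = INR (fact n).
Proof.
  induction n as [| n IH].
  - cbn; rewrite Rplus_0_l; apply GammaR_1.
  - rewrite GammaR_succ by (apply lt_0_INR; lia).
    rewrite S_INR at 2; rewrite IH, fact_simpl, mult_INR, S_INR; reflexivity.
Qed.

(** On [M, M + 1] the kernel is at least M^(x-1) e^(-M-1). *)
Lemma GammaR_lower x M : 1 <= x -> 0 < M ->
  Rpower M (x - 1) * exp (- (M + 1)) <= GammaR x.
Proof.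
  intros Hx HM.
  destruct (ex_RInt_euler_kernelR x M (M + 1)) as [I HI]; [lra |].
  apply Rle_trans with I.
  - assert (HC : is_RInt (V := R_NormedModule) (fun _ => Rpower M (x - 1) * exp (- (M + 1)))
      M (M + 1) (scal (M + 1 - M) (Rpower M (x - 1) * exp (- (M + 1)))))
      by apply (is_RInt_const (V := R_NormedModule)).
    replace (scal (M + 1 - M) (Rpower M (x - 1) * exp (- (M + 1)))) with
      (Rpower M (x - 1) * exp (- (M + 1))) in HC
      by (unfold scal; cbn; unfold mult; cbn; ring).
    apply (is_RInt_le (fun _ => Rpower M (x - 1) * exp (- (M + 1))) (euler_kernelR x) M (M + 1));
      [lra | exact HC | exact HI |].
    intros t Ht; unfold euler_kernelR; apply Rmult_le_compat; try (apply Rlt_le, exp_pos).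
    + apply Rle_Rpower_l; [lra | split; lra].
    + apply exp_le; lra.
  - apply (is_RInt_le_ImpInt (euler_kernelR x) (GammaR x)) with M (M + 1); try assumption; try lra.
    + intros; apply Rlt_le, euler_kernelR_pos.
    + apply GammaR_correct; lra.
Qed.

(** * Gauss's product represents the reciprocal of Euler's integral *)

(** The sequence whose limit defines the reciprocal Gamma function. *)
Definition gauss_quotient (s : C) (n : nat) : C :=
  (rising s (S n) / (RtoC (INR (fact n)) * Rcpow (INR n) s))%C.

Notation Clim u l := (filterlim u eventually (locally (T := C_R_NormedModule) l)).

Lemma Clim_unique (u : nat -> C) (l l' : C) : Clim u l -> Clim u l' -> l = l'.
Proof.
  intros H H'; exact (filterlim_locally_unique (V := C_R_NormedModule) u l l' H H').
Qed.

Lemma Clim_ext (u v : nat -> C) (l : C) N :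
  (forall n, (N <= n)%nat -> u n = v n) -> Clim u l -> Clim v l.
Proof. intros H; apply filterlim_ext_loc; exists N; exact H. Qed.

Lemma RtoC_neq_0 (x : R) : x <> 0 -> RtoC x <> 0.
Proof. intros H E; apply H, RtoC_inj, E. Qed.

Lemma fact_neq_0_C n : RtoC (INR (fact n)) <> 0.
Proof. apply RtoC_neq_0, INR_fact_neq_0. Qed.

Lemma Cneq_Re (z w : C) : Re z <> Re w -> z <> w.
Proof. intros H E; apply H; rewrite E; reflexivity. Qed.

(** Mean value inequality on the segment between 1 and u; the restriction on Re s bounds
    the derivative s v^(s-1) there linearly in u. *)
Lemma Rcpow_minus_1_le (u : R) (s : C) : 0 < u -> 1 <= Re s <= 2 ->
  Cmod (Rcpow u s - 1)%C <= Cmod s * (1 + u) * Rabs (u - 1).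
Proof.
  intros Hu Hs.
  replace (Rcpow u s - 1)%C with (Rcpow u s - Rcpow 1 s)%C.
  2:{ f_equal; f_equal; unfold Rcpow; rewrite ln_1, Cmult_0_r; apply Cexp_0. }
  assert (Hp : forall t, Rmin 1 u <= t <= Rmax 1 u -> 0 < t /\ (t <= 1 \/ 1 <= t <= u)).
  { intros t; unfold Rmin, Rmax; destruct Rle_dec; intros; split; lra. }
  apply (C_mean_value (fun x => Rcpow x s) (fun x => s * Rcpow x (s - 1))%C).
  - intros t Ht; apply is_derive_Rcpow, Hp, Ht.
  - intros t Ht; apply (filterlim_C_mult (locally t)); [apply filterlim_const |].
    apply continuous_Rcpow, Hp, Ht.
  - intros t Ht; destruct (Hp t Ht) as [Ht0 Ht1].
    rewrite Cmod_mult, Cmod_Rcpow.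
    apply Rmult_le_compat_l; [apply Cmod_ge_0 |].
    rewrite Re_minus; cbn [Re RtoC fst].
    destruct Ht1 as [Ht1 | Ht1].
    + apply Rle_trans with (Rpower 1 (Re s - 1)).
      * apply Rle_Rpower_l; [lra | split; lra].
      * unfold Rpower; rewrite ln_1, Rmult_0_r, exp_0; lra.
    + apply Rle_trans with (Rpower t 1).
      * destruct (Req_dec t 1) as [-> | Hne].
        { unfold Rpower; rewrite ln_1, !Rmult_0_r; lra. }
        apply Rle_Rpower; lra.
      * rewrite Rpower_1; lra.
Qed.

Lemma weighted_square (d u eps : R) : 0 < eps -> 0 < u -> d = Rabs (u - 1) ->
  (1 + u) * d <= eps + (1 + / eps) * (u - 1) ^ 2.
Proof.
  intros He Hu Hd.
  assert (E : (u - 1) ^ 2 = d ^ 2) by (rewrite Hd, pow2_abs; reflexivity).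
  assert (H0 : 0 <= d) by (rewrite Hd; apply Rabs_pos).
  assert (H1 : u - 1 <= d) by (rewrite Hd; apply Rle_abs).
  rewrite E.
  assert (H2 : 2 * d <= eps + / eps * d ^ 2).
  { apply Rmult_le_reg_l with eps; [exact He |].
    replace (eps * (eps + / eps * d ^ 2)) with (eps ^ 2 + d ^ 2) by (field; lra).
    pose proof (pow2_ge_0 (d - eps)); nra. }
  nra.
Qed.

(** Dividing by n!, the kernel t^n e^(-t) becomes the density of a Gamma law of mean n + 1,
    under which the expectation of (t/n - 1)^2 is (n + 2) / n^2. The quantity to be bounded
    is the modulus of the expectation of (t/n)^s - 1, which is at most |s| times that of
    (1 + t/n) |t/n - 1|. *)
Lemma Gamma_concentration (s : C) n : 1 <= Re s <= 2 -> (1 <= n)%nat ->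
  Cmod (GammaC (s + RtoC (INR (S n))) / (RtoC (INR (fact n)) * Rcpow (INR n) s) - 1)%C
   <= Cmod s * (7 * / sqrt (INR n)).
Proof.
  intros Hs Hn.
  set (N := INR n); assert (HN : 1 <= N) by (apply (le_INR 1), Hn).
  (* balances the two terms given by weighted_square *)
  set (eps := / sqrt N).
  assert (Hsq : 1 <= sqrt N) by (rewrite <- sqrt_1; apply sqrt_le_1_alt, HN).
  assert (He : 0 < eps) by (apply Rinv_0_lt_compat; lra).
  assert (Hsq2 : sqrt N * sqrt N = N) by (apply sqrt_sqrt; lra).
  pose proof (Rcpow_neq_0 N s) as HNs.
  set (f := fun t => (/ Rcpow N s * euler_kernel (s + RtoC (INR (S n))) t
     - euler_kernel (RtoC (N + 1)) t)%C).
  set (g := fun t => Cmod s * (eps * euler_kernelR (N + 1) t + (1 + / eps) *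
     (/ N ^ 2 * euler_kernelR (N + 1 + 1 + 1) t - 2 / N * euler_kernelR (N + 1 + 1) t + euler_kernelR (N + 1) t))).
  assert (Hf : ImpInt (V := C_R_NormedModule) f
    (minus (G := C_R_NormedModule) (/ Rcpow N s * GammaC (s + RtoC (INR (S n))))%C
      (RtoC (INR (fact n))))).
  { apply (is_RInt_gen_minus (V := C_R_NormedModule)
      (fun t => (/ Rcpow N s * euler_kernel (s + RtoC (INR (S n))) t)%C)).
    - apply ImpInt_Cmult, GammaC_correct; rewrite Re_plus, S_INR; cbn; fold N; lra.
    - rewrite <- GammaR_fact, <- GammaC_RtoC by (fold N; lra).
      apply GammaC_correct; cbn; lra. }
  assert (Hg : ImpInt (V := R_NormedModule) g
    (Cmod s * (eps * GammaR (N + 1) + (1 + / eps) *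
     (/ N ^ 2 * GammaR (N + 1 + 1 + 1) - 2 / N * GammaR (N + 1 + 1) + GammaR (N + 1))))).
  { pose proof (GammaR_correct (N + 1) ltac:(lra)) as G1.
    pose proof (GammaR_correct (N + 1 + 1) ltac:(lra)) as G2.
    pose proof (GammaR_correct (N + 1 + 1 + 1) ltac:(lra)) as G3.
    apply (is_RInt_gen_scal (V := R_NormedModule)).
    apply (is_RInt_gen_plus (V := R_NormedModule)).
    { apply (is_RInt_gen_scal (V := R_NormedModule)), G1. }
    apply (is_RInt_gen_scal (V := R_NormedModule)).
    apply (is_RInt_gen_plus (V := R_NormedModule)); [| exact G1].
    apply (is_RInt_gen_minus (V := R_NormedModule));
      apply (is_RInt_gen_scal (V := R_NormedModule)); assumption. }
  assert (Hle : Cmod (/ Rcpow N s * GammaC (s + RtoC (INR (S n))) - RtoC (INR (fact n)))%C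
     <= Cmod s * (eps + (1 + / eps) * ((N + 2) / N ^ 2)) * INR (fact n)).
  { replace (Cmod s * (eps + (1 + / eps) * ((N + 2) / N ^ 2)) * INR (fact n)) with
      (Cmod s * (eps * GammaR (N + 1) + (1 + / eps) *
       (/ N ^ 2 * GammaR (N + 1 + 1 + 1) - 2 / N * GammaR (N + 1 + 1) + GammaR (N + 1)))).
    2:{ rewrite (GammaR_succ (N + 1 + 1)), (GammaR_succ (N + 1)) by lra.
        assert (EF : GammaR (N + 1) = INR (fact n)) by apply GammaR_fact.
        rewrite EF; field; split; lra. }
    rewrite <- norm_Cmod.
    apply (ImpInt_norm_le (V := C_R_CompleteNormedModule) f g); [| exact Hf | exact Hg].
    intros t Ht; rewrite norm_Cmod.
    assert (Hu : 0 < t / N) by (apply Rdiv_lt_0_compat; lra).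
    assert (E : f t = (euler_kernel (RtoC (N + 1)) t * (Rcpow (t / N) s - 1))%C).
    { assert (E1 : Rcpow t s = (Rcpow (t / N) s * Rcpow N s)%C).
      { rewrite <- Rcpow_mult_base by lra; f_equal; field; lra. }
      unfold f, euler_kernel; rewrite S_INR; fold N.
      replace (s + RtoC (N + 1) - 1)%C with (s + (RtoC (N + 1) - 1))%C by ring.
      rewrite Rcpow_plus, E1; field; exact HNs. }
    rewrite E, Cmod_mult, Cmod_euler_kernel; cbn [Re RtoC fst].
    unfold g; rewrite (euler_kernelR_succ (N + 1 + 1)), (euler_kernelR_succ (N + 1)) by exact Ht.
    pose proof (euler_kernelR_pos (N + 1) t) as Hk.
    replace (Cmod s * _) with (euler_kernelR (N + 1) t *
      (Cmod s * (eps + (1 + / eps) * (t / N - 1) ^ 2))) by (field; split; lra).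
    apply Rmult_le_compat_l; [lra |].
    eapply Rle_trans; [apply Rcpow_minus_1_le; assumption |].
    rewrite Rmult_assoc; apply Rmult_le_compat_l; [apply Cmod_ge_0 |].
    apply weighted_square; auto. }
  pose proof (INR_fact_lt_0 n) as HF.
  replace (_ / _ - 1)%C with ((/ Rcpow N s * GammaC (s + RtoC (INR (S n)))
     - RtoC (INR (fact n))) / RtoC (INR (fact n)))%C
    by (field; split; [exact HNs | apply fact_neq_0_C]).
  rewrite Cmod_div by apply fact_neq_0_C.
  rewrite Cmod_R, (Rabs_pos_eq (INR (fact n))) by lra.
  apply Rmult_le_reg_r with (INR (fact n)); [exact HF |].
  unfold Rdiv at 1; rewrite Rmult_assoc, Rinv_l, Rmult_1_r by lra.
  eapply Rle_trans; [exact Hle |].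
  apply Rmult_le_compat_r; [lra |].
  apply Rmult_le_compat_l; [apply Cmod_ge_0 |].
  unfold eps; rewrite Rinv_inv.
  set (q := sqrt N) in *.
  rewrite <- Hsq2.
  replace (/ q + (1 + q) * ((q * q + 2) / (q * q) ^ 2)) with
    (/ q * (1 + (1 + q) * (q * q + 2) / q ^ 3)) by (field; lra).
  rewrite (Rmult_comm 7); apply Rmult_le_compat_l; [apply Rlt_le, He |].
  apply Rplus_le_reg_l with (-1).
  replace (-1 + (1 + (1 + q) * (q * q + 2) / q ^ 3)) with ((1 + q) * (q * q + 2) / q ^ 3) by ring.
  assert (0 < q ^ 3) by (apply pow_lt; lra).
  apply Rmult_le_reg_r with (q ^ 3); [assumption |].
  unfold Rdiv; rewrite Rmult_assoc, Rinv_l, Rmult_1_r by lra.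
  assert (H1 : q * q + 2 <= 3 * (q * q)) by nra.
  assert (H2 : 1 + q <= 2 * q) by lra.
  apply Rle_trans with (2 * q * (3 * (q * q))).
  - apply Rmult_le_compat; nra.
  - right; ring.
Qed.

Lemma lim_inv_sqrt : is_lim_seq (fun n => / sqrt (INR n)) 0.
Proof.
  apply (is_lim_seq_inv _ p_infty); [| discriminate].
  eapply filterlim_comp; [apply is_lim_seq_INR | apply filterlim_sqrt_p].
Qed.

Lemma lim_inv_INR : is_lim_seq (fun n => / INR n) 0.
Proof. apply (is_lim_seq_inv _ p_infty); [apply is_lim_seq_INR | discriminate]. Qed.

Lemma rising_GammaC (s : C) n : 0 < Re s ->
  GammaC (s + RtoC (INR n))%C = (rising s n * GammaC s)%C.
Proof.
  intros Hs; induction n as [| n IH].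
  - cbn [INR rising]; rewrite Cplus_0_r, Cmult_1_l; reflexivity.
  - cbn [rising]; rewrite S_INR, RtoC_plus, Cplus_assoc, GammaC_succ, IH; [ring |].
    rewrite Re_plus; cbn; pose proof (pos_INR n); lra.
Qed.

Lemma rising_succ_l (s : C) n : rising s (S n) = (s * rising (s + 1)%C n)%C.
Proof.
  induction n as [| n IH]; [cbn; ring |].
  change (rising s (S (S n))) with (rising s (S n) * (s + RtoC (INR (S n))))%C.
  rewrite IH; cbn [rising]; rewrite S_INR, RtoC_plus; ring.
Qed.

Lemma gauss_quotient_succ (s : C) n : (1 <= n)%nat ->
  (gauss_quotient (s + 1)%C n * s = gauss_quotient s n * (1 + (s + 1) * RtoC (/ INR n)))%C.
Proof.
  intros Hn.
  assert (HN : INR n <> 0) by (apply not_0_INR; lia).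
  assert (HN' : 0 < INR n) by (apply lt_0_INR; lia).
  unfold gauss_quotient; rewrite Rcpow_succ by exact HN'.
  assert (E : (s * rising (s + 1) (S n) = rising s (S n) * (s + RtoC (INR n) + 1))%C).
  { rewrite <- rising_succ_l.
    change (rising s (S (S n))) with (rising s (S n) * (s + RtoC (INR (S n))))%C.
    rewrite S_INR, RtoC_plus; ring. }
  rewrite RtoC_inv by exact HN.
  pose proof (Rcpow_neq_0 (INR n) s); pose proof (fact_neq_0_C n).
  pose proof (RtoC_neq_0 _ HN).
  transitivity ((s * rising (s + 1) (S n)) /
    (RtoC (INR (fact n)) * Rcpow (INR n) s * RtoC (INR n)))%C; [field; auto |].
  rewrite E; field; auto.
Qed.

Lemma lim_one_plus (c : C) : Clim (fun n => 1 + c * RtoC (/ INR n))%C (RtoC 1).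
Proof.
  apply filterlim_C_le with (fun n => Cmod c * / INR n); [apply _ | |].
  - exists 1%nat; intros n Hn; replace (_ - 1)%C with (c * RtoC (/ INR n))%C by ring.
    rewrite Cmod_mult, Cmod_R, Rabs_pos_eq; [lra |].
    apply Rlt_le, Rinv_0_lt_compat, lt_0_INR; lia.
  - change (is_lim_seq (fun n => Cmod c * / INR n) 0).
    replace (Finite 0) with (Rbar_mult (Cmod c) 0) by (cbn; f_equal; ring).
    apply is_lim_seq_scal_l, lim_inv_INR.
Qed.

Lemma gauss_quotient_lim_up (s l : C) : s <> 0 -> Clim (gauss_quotient s) l -> Clim (gauss_quotient (s + 1)%C) (l / s)%C.
Proof.
  intros Hs H.
  apply Clim_ext with (fun n => gauss_quotient s n * (1 + (s + 1) * RtoC (/ INR n)) * / s)%C 1%nat.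
  - intros n Hn; rewrite <- gauss_quotient_succ by exact Hn; field; exact Hs.
  - replace (l / s)%C with (l * 1 * / s)%C by (field; exact Hs).
    apply (filterlim_C_mult eventually); [| apply filterlim_const].
    apply (filterlim_C_mult eventually); [exact H | apply lim_one_plus].
Qed.

(** The quotients at s and s + 1 differ by a factor tending to s. This direction needs no
    assumption on s, and so extends convergence to the whole plane. *)
Lemma gauss_quotient_lim_down (s l : C) : Clim (gauss_quotient (s + 1)%C) l -> Clim (gauss_quotient s) (s * l)%C.
Proof.
  intros H.
  destruct (nfloor_ex (Cmod (s + 1)%C)) as [N [_ HN]]; [apply Cmod_ge_0 |].
  set (c := (s + 1)%C) in *.
  assert (Hnz : forall n, (N + 1 <= n)%nat -> (RtoC (INR n) + c <> 0)%C
     /\ INR n - Cmod c <= Cmod (RtoC (INR n) + c)%C /\ 0 < INR n - Cmod c).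
  { intros n Hn.
    assert (H1 : Cmod c < INR n).
    { apply le_INR in Hn; rewrite plus_INR in Hn; cbn in Hn; lra. }
    assert (H2 : INR n - Cmod c <= Cmod (RtoC (INR n) + c)%C).
    { pose proof (Cmod_triangle (RtoC (INR n) + c)%C (- c)%C) as T.
      replace (RtoC (INR n) + c + - c)%C with (RtoC (INR n)) in T by ring.
      rewrite Cmod_opp, Cmod_R, Rabs_pos_eq in T by apply pos_INR; lra. }
    split; [apply Cmod_gt_0; lra | split; lra]. }
  apply Clim_ext with (fun n => s * (gauss_quotient c n * (RtoC (INR n) / (RtoC (INR n) + c))))%C (N + 1)%nat.
  - intros n Hn; destruct (Hnz n Hn) as [Hz _].
    assert (HN' : RtoC (INR n) <> 0) by (apply RtoC_neq_0, not_0_INR; lia).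
    pose proof (gauss_quotient_succ s n ltac:(lia)) as E; fold c in E.
    replace (s * _)%C with (gauss_quotient c n * s * (RtoC (INR n) / (RtoC (INR n) + c)))%C
      by (unfold Cdiv; ring).
    rewrite E, RtoC_inv by (apply not_0_INR; lia); field; auto.
  - apply (filterlim_C_mult eventually); [apply filterlim_const |].
    replace l with (l * 1)%C at 1 by ring.
    apply (filterlim_C_mult eventually); [exact H |].
    apply filterlim_C_le with (fun n => Cmod c * / (INR n - Cmod c)); [apply _ | |].
    + exists (N + 1)%nat; intros n Hn; destruct (Hnz n Hn) as (Hz & Hle & Hp).
      replace (_ - 1)%C with (- c / (RtoC (INR n) + c))%C by (field; exact Hz).
      rewrite Cmod_div, Cmod_opp by exact Hz.
      apply Rmult_le_compat_l; [apply Cmod_ge_0 |].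
      apply Rinv_le_contravar; lra.
    + change (is_lim_seq (fun n => Cmod c * / (INR n - Cmod c)) 0).
      replace (Finite 0) with (Rbar_mult (Cmod c) 0) by (cbn; f_equal; ring).
      apply is_lim_seq_scal_l.
      apply (is_lim_seq_inv _ p_infty); [| discriminate].
      apply is_lim_seq_minus with p_infty (Cmod c);
        [apply is_lim_seq_INR | apply is_lim_seq_const | reflexivity].
Qed.

(** By the functional equation of Euler's integral, the n-th Gauss quotient times
    GammaC s is the ratio that concentrates at 1. The limit 1 also shows that GammaC s
    does not vanish. *)
Lemma gauss_quotient_lim_strip (s : C) : 1 <= Re s <= 2 ->
  exists l, Clim (gauss_quotient s) l /\ (l * GammaC s = 1)%C.
Proof.
  intros Hs.
  assert (H : Clim (fun n => gauss_quotient s n * GammaC s)%C (RtoC 1)).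
  { apply filterlim_C_le with (fun n => Cmod s * (7 * / sqrt (INR n))); [apply _ | |].
    - exists 1%nat; intros n Hn.
      eapply Rle_trans; [right | apply Gamma_concentration; eassumption].
      rewrite rising_GammaC by lra; unfold gauss_quotient; f_equal; unfold Cdiv; ring.
    - change (is_lim_seq (fun n => Cmod s * (7 * / sqrt (INR n))) 0).
      replace (Finite 0) with (Rbar_mult (Cmod s) (Rbar_mult 7 0))
        by (cbn; f_equal; ring).
      apply is_lim_seq_scal_l, is_lim_seq_scal_l, lim_inv_sqrt. }
  assert (HG : GammaC s <> 0).
  { intros E.
    assert (E1 : RtoC 1 = RtoC 0).
    { apply (Clim_unique _ _ _ H), (Clim_ext (fun _ => RtoC 0)) with O.
      - intros n _; rewrite E; ring.
      - apply filterlim_const. }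
    apply RtoC_inj in E1; lra. }
  exists (/ GammaC s)%C; split; [| field; exact HG].
  apply Clim_ext with (fun n => gauss_quotient s n * GammaC s * / GammaC s)%C O.
  - intros; field; exact HG.
  - pose proof (filterlim_C_mult eventually _ (fun _ => / GammaC s)%C _ _ H
      (filterlim_const _)) as H1.
    rewrite Cmult_1_l in H1; exact H1.
Qed.

Lemma gauss_quotient_lim_right N : forall s : C, 1 <= Re s <= INR N + 2 ->
  exists l, Clim (gauss_quotient s) l /\ (l * GammaC s = 1)%C.
Proof.
  induction N as [| N IH]; intros s Hs.
  - apply gauss_quotient_lim_strip; cbn in Hs; lra.
  - destruct (Rle_dec (Re s) 2) as [H2 | H2]; [apply gauss_quotient_lim_strip; lra |].
    rewrite S_INR in Hs.
    assert (Es : s = ((s - 1) + 1)%C) by ring.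
    assert (Hr : Re (s - 1)%C = Re s - 1) by reflexivity.
    destruct (IH (s - 1)%C) as (l & Hl & HG); [lra |].
    assert (Hnz : (s - 1 <> 0)%C) by (apply Cneq_Re; rewrite Hr; cbn; lra).
    exists (l / (s - 1))%C; rewrite Es at 1 4; split.
    + apply gauss_quotient_lim_up; assumption.
    + rewrite GammaC_succ by lra.
      replace (_ * _)%C with (l * GammaC (s - 1))%C by (field; exact Hnz); exact HG.
Qed.

Lemma gauss_quotient_lim_Gamma (s : C) : 0 < Re s ->
  exists l, Clim (gauss_quotient s) l /\ (l * GammaC s = 1)%C.
Proof.
  intros Hs.
  assert (H1 : forall w : C, 1 <= Re w -> exists l, Clim (gauss_quotient w) l /\ (l * GammaC w = 1)%C).
  { intros w Hw; destruct (nfloor_ex (Re w)) as [N [_ HN]]; [lra |].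
    apply gauss_quotient_lim_right with N; lra. }
  destruct (H1 (s + 1)%C) as (l & Hl & HG); [rewrite Re_plus; cbn; lra |].
  exists (s * l)%C; split; [apply gauss_quotient_lim_down, Hl |].
  rewrite GammaC_succ in HG by exact Hs; rewrite <- HG; ring.
Qed.

Lemma gauss_quotient_lim_ex N : forall s : C, - INR N < Re s -> exists l, Clim (gauss_quotient s) l.
Proof.
  induction N as [| N IH]; intros s Hs.
  - destruct (gauss_quotient_lim_Gamma s) as (l & Hl & _); [cbn in Hs; lra | eauto].
  - rewrite S_INR in Hs.
    destruct (IH (s + 1)%C) as [l Hl]; [rewrite Re_plus; cbn; lra |].
    eexists; apply gauss_quotient_lim_down, Hl.
Qed.

Lemma rGamma_correct (s : C) : Clim (gauss_quotient s) (rGamma s).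
Proof.
  assert (H : exists l, Clim (gauss_quotient s) l).
  { destruct (nfloor_ex (Rabs (Re s))) as [N [_ HN]]; [apply Rabs_pos |].
    apply gauss_quotient_lim_ex with (S N); rewrite S_INR.
    assert (- Rabs (Re s) <= Re s) by (unfold Rabs; destruct Rcase_abs; lra); lra. }
  destruct H as [l Hl].
  enough (E : rGamma s = l) by (rewrite E; exact Hl).
  apply (iota_filterlim_locally (V := C_R_CompleteNormedModule) _ _ Hl).
Qed.

Lemma rGamma_GammaC (s : C) : 0 < Re s -> (rGamma s * GammaC s = 1)%C.
Proof.
  intros Hs; destruct (gauss_quotient_lim_Gamma s Hs) as (l & Hl & HG).
  rewrite (Clim_unique _ _ _ (rGamma_correct s) Hl); exact HG.
Qed.

Lemma rGamma_succ (s : C) : rGamma s = (s * rGamma (s + 1))%C.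
Proof.
  apply (Clim_unique (gauss_quotient s)); [| apply gauss_quotient_lim_down]; apply rGamma_correct.
Qed.

Lemma rGamma_RtoC x : 0 < x -> rGamma (RtoC x) = RtoC (/ GammaR x) /\ 0 < GammaR x.
Proof.
  intros Hx; pose proof (rGamma_GammaC (RtoC x) Hx) as H.
  rewrite GammaC_RtoC in H by exact Hx.
  assert (H0 : GammaR x <> 0).
  { intros E; rewrite E, Cmult_0_r in H; apply RtoC_inj in H; lra. }
  assert (H1 : 0 <= GammaR x).
  { apply (ImpInt_R_le (fun _ => 0) (euler_kernelR x) 0 (GammaR x)).
    - intros; apply Rlt_le, euler_kernelR_pos.
    - apply ImpInt_spec; intros eps He; exists 1, 1; split; [lra |]; intros u v Hu Hv.
      exists 0; split.
      + pose proof (is_RInt_const (V := R_NormedModule) u v 0) as HC.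
        change (scal (v - u) 0) with ((v - u) * 0) in HC; rewrite Rmult_0_r in HC; exact HC.
      + change (Rabs (0 - 0) < eps); rewrite Rminus_0_r, Rabs_R0; exact He.
    - apply GammaR_correct, Hx. }
  split; [| lra].
  rewrite RtoC_inv by exact H0.
  pose proof (RtoC_neq_0 _ H0).
  transitivity (rGamma (RtoC x) * RtoC (GammaR x) / RtoC (GammaR x))%C; [field; assumption |].
  rewrite H; field; assumption.
Qed.

(** * Wallis's product and Legendre's duplication formula *)

Definition wallis (n : nat) : R := RInt (fun x => sin x ^ n) 0 (PI / 2).

Lemma continuous_sin_pow n x : continuous (fun x => sin x ^ n) x.
Proof.
  apply (ex_derive_continuous (K := R_AbsRing) (V := R_NormedModule)).
  auto_derive; exact I.
Qed.

Lemma wallis_correct n : is_RInt (fun x => sin x ^ n) 0 (PI / 2) (wallis n).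
Proof.
  apply (RInt_correct (V := R_CompleteNormedModule)).
  apply (ex_RInt_continuous (V := R_CompleteNormedModule)); intros; apply continuous_sin_pow.
Qed.

Lemma wallis_0 : wallis 0 = PI / 2.
Proof.
  apply is_RInt_unique.
  replace (PI / 2) with (scal (PI / 2 - 0) 1) at 2
    by (unfold scal; cbn; unfold mult; cbn; ring).
  apply (is_RInt_const (V := R_NormedModule)).
Qed.

Lemma wallis_1 : wallis 1 = 1.
Proof.
  apply is_RInt_unique.
  assert (H : is_RInt (fun x => sin x ^ 1) 0 (PI / 2)
    (minus (- cos (PI / 2)) (- cos 0))).
  { apply (is_RInt_derive (V := R_CompleteNormedModule) (fun x => - cos x)).
    - intros x _; auto_derive; [exact I | ring].
    - intros x _; apply continuous_sin_pow. }
  rewrite cos_PI2, cos_0 in H.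
  replace 1 with (- 0 - - 1) by ring; exact H.
Qed.

(** The primitive - cos x sin^(n+1) x vanishes at both ends of [0, PI / 2]. *)
Lemma wallis_rec n : (INR n + 2) * wallis (S (S n)) = (INR n + 1) * wallis n.
Proof.
  set (f := fun x => (INR n + 2) * sin x ^ (S (S n)) - (INR n + 1) * sin x ^ n).
  assert (H : is_RInt f 0 (PI / 2)
    (minus (- cos (PI / 2) * sin (PI / 2) ^ S n) (- cos 0 * sin 0 ^ S n))).
  { apply (is_RInt_derive (V := R_CompleteNormedModule) (fun x => - cos x * sin x ^ S n)).
    - intros x _; unfold f; auto_derive; [exact I |].
      change (match n with O => 1 | S _ => INR n + 1 end) with (INR (S n)).
      rewrite S_INR.
      pose proof (sin2_cos2 x) as E; unfold Rsqr in E.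
      cbn [pow].
      replace (- cos x * (1 * cos x * ((INR n + 1) * sin x ^ n))) with
        (- (cos x * cos x) * (INR n + 1) * sin x ^ n) by ring.
      replace (cos x * cos x) with (1 - sin x * sin x) by lra.
      ring.
    - intros x _; apply (ex_derive_continuous (K := R_AbsRing) (V := R_NormedModule)).
      unfold f; auto_derive; repeat split. }
  assert (H2 : is_RInt f 0 (PI / 2)
    (minus ((INR n + 2) * wallis (S (S n))) ((INR n + 1) * wallis n))).
  { apply (is_RInt_minus (V := R_NormedModule));
      apply (is_RInt_scal (V := R_NormedModule)); apply wallis_correct. }
  apply (is_RInt_unique (V := R_CompleteNormedModule)) in H.
  apply (is_RInt_unique (V := R_CompleteNormedModule)) in H2; rewrite H in H2.
  rewrite cos_PI2, sin_0 in H2.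
  change (- 0 * (sin (PI / 2) * sin (PI / 2) ^ n) - - cos 0 * (0 * 0 ^ n) =
    (INR n + 2) * wallis (S (S n)) - (INR n + 1) * wallis n) in H2.
  lra.
Qed.

Lemma wallis_decr n : wallis (S n) <= wallis n.
Proof.
  apply (is_RInt_le (fun x => sin x ^ S n) (fun x => sin x ^ n) 0 (PI / 2));
    try apply wallis_correct; [pose proof PI_RGT_0; lra |].
  intros x Hx.
  assert (0 <= sin x) by (apply sin_ge_0; lra).
  pose proof (SIN_bound x); cbn [pow].
  rewrite <- (Rmult_1_l (sin x ^ n)) at 2.
  apply Rmult_le_compat_r; [apply pow_le; assumption | lra].
Qed.

(** The ratio of the central binomial coefficient C(2n, n) to 4^n. *)
Fixpoint cbin_ratio (n : nat) : R :=
  match n with O => 1 | S m => cbin_ratio m * ((2 * INR m + 1) / (2 * INR m + 2)) end.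

Lemma cbin_ratio_pos n : 0 < cbin_ratio n.
Proof.
  induction n as [| n IH]; cbn [cbin_ratio]; [lra |].
  pose proof (pos_INR n); apply Rmult_lt_0_compat; [exact IH |].
  apply Rdiv_lt_0_compat; lra.
Qed.

Lemma wallis_cbin_ratio n :
  wallis (2 * n) = cbin_ratio n * (PI / 2) /\ wallis (S (2 * n)) = / ((2 * INR n + 1) * cbin_ratio n).
Proof.
  induction n as [| n [IH1 IH2]].
  - change (2 * 0)%nat with 0%nat; cbn [cbin_ratio INR]; rewrite wallis_0, wallis_1; split; field.
  - pose proof (pos_INR n); pose proof (cbin_ratio_pos n).
    replace (2 * S n)%nat with (S (S (2 * n))) by lia.
    pose proof (wallis_rec (2 * n)) as H1; pose proof (wallis_rec (S (2 * n))) as H2.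
    rewrite IH1 in H1; rewrite IH2 in H2.
    rewrite ?S_INR, mult_INR in H1; rewrite S_INR, mult_INR in H2; cbn [INR] in H1, H2.
    split.
    + apply Rmult_eq_reg_l with (2 * INR n + 2); [| lra].
      cbn [cbin_ratio]; transitivity (((1 + 1) * INR n + 1) * (cbin_ratio n * (PI / 2)));
        [rewrite <- H1; ring | field; lra].
    + apply Rmult_eq_reg_l with (2 * INR n + 3); [| lra].
      rewrite S_INR; cbn [cbin_ratio].
      transitivity ((2 * INR n + 2) * / ((2 * INR n + 1) * cbin_ratio n));
        [| field; repeat split; lra].
      replace (2 * INR n + 2) with ((1 + 1) * INR n + 1 + 1) by ring.
      rewrite <- H2; ring.
Qed.

(** Wallis's inequalities: the integrals of sin^(2n+2), sin^(2n+1) and sin^(2n) form a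
    nondecreasing sequence. *)
Lemma cbin_ratio_bounds n : 2 / PI <= cbin_ratio n ^ 2 * (2 * INR n + 1) <=
  2 / PI * ((2 * INR n + 2) / (2 * INR n + 1)).
Proof.
  destruct (wallis_cbin_ratio n) as [H1 H2].
  destruct (wallis_cbin_ratio (S n)) as [H3 _].
  pose proof (wallis_decr (2 * n)) as D1; pose proof (wallis_decr (S (2 * n))) as D2.
  replace (S (S (2 * n))) with (2 * S n)%nat in D2 by lia.
  rewrite H3 in D2; rewrite H2 in D1, D2; rewrite H1 in D1; cbn [cbin_ratio] in D2.
  pose proof (pos_INR n); pose proof (cbin_ratio_pos n) as Hc; pose proof PI_RGT_0.
  set (a := cbin_ratio n) in *; set (m := 2 * INR n + 1) in *.
  assert (Hm : 0 < m) by (unfold m; lra).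
  replace (2 * INR n + 2) with (m + 1) in * by (unfold m; ring).
  assert (Hma : 0 < m * a) by (apply Rmult_lt_0_compat; lra).
  split.
  - apply Rmult_le_compat_r with (r := m * a * (2 / PI)) in D1.
    2:{ apply Rmult_le_pos; [lra | apply Rlt_le, Rdiv_lt_0_compat; lra]. }
    replace (/ (m * a) * (m * a * (2 / PI))) with (2 / PI) in D1 by (field; repeat split; lra).
    eapply Rle_trans; [exact D1 | right; field; lra].
  - apply Rmult_le_compat_r with (r := m * a * (2 / PI) * ((m + 1) / m)) in D2.
    2:{ repeat apply Rmult_le_pos; try lra; apply Rlt_le, Rinv_0_lt_compat; lra. }
    replace (/ (m * a) * (m * a * (2 / PI) * ((m + 1) / m))) with (2 / PI * ((m + 1) / m)) in D2
      by (field; repeat split; lra).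
    eapply Rle_trans; [right | exact D2]; field; repeat split; lra.
Qed.

Lemma rising_half n :
  rising (RtoC (1 / 2)) (S n) = RtoC (INR (fact n) * cbin_ratio n * (2 * INR n + 1) / 2).
Proof.
  induction n as [| n IH].
  - cbn [rising fact cbin_ratio INR]; rewrite <- !RtoC_plus, <- !RtoC_mult; f_equal; field.
  - change (rising (RtoC (1 / 2)) (S (S n))) with
      (rising (RtoC (1 / 2)) (S n) * (RtoC (1 / 2) + RtoC (INR (S n))))%C.
    rewrite IH, <- RtoC_plus, <- RtoC_mult; f_equal.
    pose proof (pos_INR n).
    rewrite fact_simpl, mult_INR, !S_INR; cbn [cbin_ratio]; field; lra.
Qed.

Lemma fact_odd_rising n : RtoC (INR (fact (2 * n + 1))) =
  (RtoC (2 ^ (2 * n + 1) * INR (fact n)) * rising (RtoC (1 / 2)) (S n))%C.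
Proof.
  rewrite rising_half, <- RtoC_mult; f_equal.
  induction n as [| n IH].
  - cbn; field.
  - replace (2 * S n + 1)%nat with (S (S (2 * n + 1))) by lia.
    rewrite !fact_simpl, !mult_INR, IH, !S_INR, plus_INR, mult_INR.
    cbn [pow cbin_ratio INR]; pose proof (pos_INR n); field; lra.
Qed.

(** The square of the n-th Gauss quotient at 1/2 lies between 1 / PI and (1 + 1/n) / PI. *)
Lemma rGamma_half : rGamma (RtoC (1 / 2)) = RtoC (/ sqrt PI).
Proof.
  destruct (rGamma_RtoC (1 / 2)) as [E HG]; [lra |].
  set (G := GammaR (1 / 2)) in *.
  pose proof (rGamma_correct (RtoC (1 / 2))) as H; rewrite E in H.
  pose proof (filterlim_C_mult eventually _ _ _ _ H H) as H2.
  assert (H3 : Clim (fun n => gauss_quotient (RtoC (1 / 2)) n * gauss_quotient (RtoC (1 / 2)) n)%C (RtoC (/ PI))).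
  { apply filterlim_C_le with (fun n => / PI * / INR n); [apply _ | |].
    - exists 1%nat; intros n Hn.
      assert (HN : 1 <= INR n) by (apply (le_INR 1), Hn).
      pose proof PI_RGT_0; pose proof (INR_fact_lt_0 n).
      assert (Hs : 0 < sqrt (INR n)) by (apply sqrt_lt_R0; lra).
      assert (Hss : sqrt (INR n) ^ 2 = INR n) by (apply pow2_sqrt; lra).
      assert (Eg : gauss_quotient (RtoC (1 / 2)) n = RtoC (cbin_ratio n * (2 * INR n + 1) / (2 * sqrt (INR n)))).
      { unfold gauss_quotient; rewrite rising_half, Rcpow_RtoC.
        replace (1 / 2) with (/ 2) at 1 by field; rewrite Rpower_sqrt by lra.
        rewrite <- RtoC_mult, <- RtoC_div by (apply Rmult_integral_contrapositive; lra).
        f_equal; field; repeat split; lra. }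
      rewrite Eg, <- RtoC_mult, <- RtoC_minus, Cmod_R.
      pose proof (cbin_ratio_bounds n) as B.
      replace (cbin_ratio n * (2 * INR n + 1) / (2 * sqrt (INR n)) *
        (cbin_ratio n * (2 * INR n + 1) / (2 * sqrt (INR n)))) with
        (cbin_ratio n ^ 2 * (2 * INR n + 1) * ((2 * INR n + 1) / (4 * INR n))).
      2:{ transitivity (cbin_ratio n ^ 2 * (2 * INR n + 1) * (2 * INR n + 1) / (4 * sqrt (INR n) ^ 2));
          [rewrite Hss; field; lra | field; lra]. }
      set (q := cbin_ratio n ^ 2 * (2 * INR n + 1)) in *.
      assert (Hk : 0 < (2 * INR n + 1) / (4 * INR n)) by (apply Rdiv_lt_0_compat; lra).
      destruct B as [B1 B2].
      apply Rmult_le_compat_r with (r := (2 * INR n + 1) / (4 * INR n)) in B1; [| lra].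
      apply Rmult_le_compat_r with (r := (2 * INR n + 1) / (4 * INR n)) in B2; [| lra].
      replace (2 / PI * ((2 * INR n + 1) / (4 * INR n))) with (/ PI + / PI * / INR n * / 2) in B1
        by (field; lra).
      replace (2 / PI * ((2 * INR n + 2) / (2 * INR n + 1)) * ((2 * INR n + 1) / (4 * INR n)))
        with (/ PI + / PI * / INR n) in B2 by (field; lra).
      assert (0 < / PI * / INR n) by (apply Rmult_lt_0_compat; apply Rinv_0_lt_compat; lra).
      rewrite Rabs_pos_eq; lra.
    - change (is_lim_seq (fun n => / PI * / INR n) 0).
      replace (Finite 0) with (Rbar_mult (/ PI) 0) by (cbn; f_equal; ring).
      apply is_lim_seq_scal_l, lim_inv_INR. }
  pose proof (Clim_unique _ _ _ H2 H3) as E2.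
  rewrite <- RtoC_mult in E2; apply RtoC_inj in E2.
  rewrite E; f_equal.
  rewrite <- sqrt_inv, <- E2; symmetry; apply sqrt_square.
  apply Rlt_le, Rinv_0_lt_compat, HG.
Qed.

Lemma rising_double (s : C) n :
  (rising (RtoC 2 * s) (2 * n) = RtoC (2 ^ (2 * n)) * (rising s n * rising (s + RtoC (1 / 2)) n))%C.
Proof.
  induction n as [| n IH].
  - cbn; ring.
  - replace (2 * S n)%nat with (S (S (2 * n))) by lia.
    cbn [rising pow]; rewrite IH, S_INR, mult_INR; cbn [INR].
    rewrite !RtoC_plus, !RtoC_mult, RtoC_plus.
    replace (RtoC (1 / 2)) with (/ RtoC 2)%C by (rewrite <- RtoC_inv by lra; f_equal; field).
    replace (RtoC 2) with (1 + 1)%C by (rewrite <- RtoC_plus; f_equal; ring).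
    field.
Qed.

(** The 2n + 2 factors of the rising factorial of 2 s split into even and odd ones, which are
    the factors at s and s + 1/2. At s = 1/2 the same splitting turns (2n+1)! into a rising
    factorial of 1/2, whence the Gauss quotient at 1/2. *)
Lemma gauss_quotient_double (s : C) n : (1 <= n)%nat ->
  (gauss_quotient s n * gauss_quotient (s + RtoC (1 / 2)) n =
   gauss_quotient (RtoC 2 * s) (2 * n + 1) * (gauss_quotient (RtoC (1 / 2)) n * RtoC (/ 2)
     * Rcpow ((2 * INR n + 1) * / INR n) (RtoC 2 * s)))%C.
Proof.
  intros Hn.
  assert (HN : 0 < INR n) by (apply lt_0_INR; lia).
  assert (HI : 0 < / INR n) by (apply Rinv_0_lt_compat, HN).
  unfold gauss_quotient.
  replace (S (2 * n + 1)) with (2 * S n)%nat by lia.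
  rewrite rising_double, fact_odd_rising.
  replace (INR (2 * n + 1)) with (2 * INR n + 1)
    by (rewrite plus_INR, mult_INR; cbn [INR]; ring).
  replace (2 ^ (2 * S n)) with (2 * 2 ^ (2 * n + 1))
    by (replace (2 * S n)%nat with (S (2 * n + 1)) by lia; reflexivity).
  rewrite Rcpow_mult_base by lra.
  assert (E : (Rcpow (/ INR n) (RtoC 2 * s) * (Rcpow (INR n) s * Rcpow (INR n) s) = 1)%C).
  { rewrite <- Rcpow_plus; replace (s + s)%C with (RtoC 2 * s)%C.
    - rewrite <- Rcpow_mult_base, Rinv_l by lra.
      unfold Rcpow; rewrite ln_1, Cmult_0_r; apply Cexp_0.
    - replace (RtoC 2) with (1 + 1)%C by (rewrite <- RtoC_plus; f_equal; ring); ring. }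
  rewrite Rcpow_plus.
  pose proof (Rcpow_neq_0 (INR n) s); pose proof (Rcpow_neq_0 (INR n) (RtoC (1 / 2))).
  pose proof (Rcpow_neq_0 (2 * INR n + 1) (RtoC 2 * s)%C).
  pose proof (fact_neq_0_C n).
  assert (Hr : rising (RtoC (1 / 2)) (S n) <> 0).
  { rewrite rising_half; apply RtoC_neq_0.
    pose proof (cbin_ratio_pos n); pose proof (INR_fact_lt_0 n).
    assert (0 < INR (fact n) * cbin_ratio n * (2 * INR n + 1)); [| lra].
    repeat apply Rmult_lt_0_compat; lra. }
  assert (Hpow : RtoC (2 ^ (2 * n + 1)) <> 0) by (apply RtoC_neq_0, pow_nonzero; lra).
  assert (H20 : RtoC 2 <> 0) by (apply RtoC_neq_0; lra).
  rewrite !RtoC_mult, RtoC_inv by lra.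
  set (X := Rcpow (/ INR n) (RtoC 2 * s)%C) in *; set (Y := Rcpow (INR n) s) in *.
  replace X with (/ (Y * Y))%C.
  - field; repeat split; auto.
  - transitivity (X * (Y * Y) / (Y * Y))%C; [rewrite E; field; auto | field; auto].
Qed.

(** Legendre's duplication formula. The subsequence of odd indices computes the limit at
    2 s; the constant comes from the value at 1/2. *)
Lemma rGamma_duplication (s : C) :
  (rGamma s * rGamma (s + RtoC (1 / 2)) =
   rGamma (RtoC 2 * s) * (RtoC (/ sqrt PI) * RtoC (/ 2) * Rcpow 2 (RtoC 2 * s)))%C.
Proof.
  apply (Clim_unique (fun n => gauss_quotient s n * gauss_quotient (s + RtoC (1 / 2)) n)%C).
  { apply (filterlim_C_mult eventually); apply rGamma_correct. }
  eapply Clim_ext with (N := 1%nat).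
  { intros n Hn; symmetry; apply gauss_quotient_double, Hn. }
  apply (filterlim_C_mult eventually); [| apply (filterlim_C_mult eventually)].
  - apply (filterlim_comp _ _ _ (fun n => 2 * n + 1)%nat (gauss_quotient (RtoC 2 * s)) eventually eventually).
    + intros P [N HP]; exists N; intros n Hn; apply HP; lia.
    + apply rGamma_correct.
  - rewrite <- rGamma_half; apply (filterlim_C_mult eventually);
      [apply rGamma_correct | apply filterlim_const].
  - apply (filterlim_comp _ _ _ (fun n => (2 * INR n + 1) * / INR n)
      (fun x => Rcpow x (RtoC 2 * s)) eventually (locally 2)).
    + change (is_lim_seq (fun n => (2 * INR n + 1) * / INR n) 2).
      apply (is_lim_seq_ext_loc (fun n => 2 + / INR n)).
      * exists 1%nat; intros n Hn; field; apply not_0_INR; lia.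
      * replace (Finite 2) with (Finite (2 + 0)) by (f_equal; ring).
        apply (is_lim_seq_plus' _ _ 2 0); [apply is_lim_seq_const | apply lim_inv_INR].
    + apply (continuous_Rcpow 2); lra.
Qed.

(** * Decay of the reciprocal Gamma function along rays *)

Lemma Cmod_le_exp (w : C) : 0 < Re w ->
  Cmod w <= Re w * exp (Im w ^ 2 / (2 * Re w ^ 2)).
Proof.
  intros Hw.
  apply Rsqr_incr_0_var; [| apply Rlt_le, Rmult_lt_0_compat; [exact Hw | apply exp_pos]].
  rewrite Rsqr_mult, !Rsqr_pow2, Cmod2_alt.
  replace (exp (Im w ^ 2 / (2 * Re w ^ 2)) ^ 2) with (exp (Im w ^ 2 / Re w ^ 2)).
  2:{ transitivity (exp (Im w ^ 2 / (2 * Re w ^ 2)) * exp (Im w ^ 2 / (2 * Re w ^ 2)));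
      [rewrite <- exp_plus; f_equal; field; lra | ring]. }
  replace (Re w ^ 2 + Im w ^ 2) with (Re w ^ 2 * (1 + Im w ^ 2 / Re w ^ 2)) by (field; lra).
  apply Rmult_le_compat_l; [apply pow2_ge_0 | apply exp_ineq1_le].
Qed.

(** By |w| <= Re w exp((Im w)^2 / (2 (Re w)^2)), each factor costs at most
    exp(y^2 / (2 (x + m)^2)), with x and y the real and imaginary parts of s; the sum
    of the 1 / (x + m)^2 for m >= 1 telescopes below 1 / x - 1 / (x + n). *)
Lemma rising_le (s : C) n : 0 < Re s ->
  Cmod (rising s (S n)) <= Cmod (rising (RtoC (Re s)) (S n)) *
    exp (Im s ^ 2 / 2 * (/ Re s ^ 2 + / Re s - / (Re s + INR n))).
Proof.
  intros Hs; set (x := Re s) in *; set (y := Im s).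
  assert (Hf : forall m, Cmod (s + RtoC (INR m))%C <=
    Cmod (RtoC x + RtoC (INR m))%C * exp (y ^ 2 / 2 * / (x + INR m) ^ 2)).
  { intros m; pose proof (pos_INR m).
    assert (Er : Re (s + RtoC (INR m))%C = x + INR m) by reflexivity.
    assert (Ei : Im (s + RtoC (INR m))%C = y) by (cbn; unfold y, Im; ring).
    rewrite <- RtoC_plus, Cmod_R, Rabs_pos_eq by lra.
    eapply Rle_trans; [apply Cmod_le_exp; lra |].
    rewrite Er, Ei; right; f_equal; f_equal; field; lra. }
  induction n as [| n IH].
  - cbn [rising]; rewrite !Cmod_mult; eapply Rle_trans; [apply Rmult_le_compat_l; [apply Cmod_ge_0 | apply Hf] |].
    cbn [INR]; right; rewrite <- Rmult_assoc; f_equal; f_equal; f_equal; field; lra.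
  - change (rising s (S (S n))) with (rising s (S n) * (s + RtoC (INR (S n))))%C.
    change (rising (RtoC x) (S (S n))) with
      (rising (RtoC x) (S n) * (RtoC x + RtoC (INR (S n))))%C.
    rewrite !Cmod_mult.
    eapply Rle_trans; [apply Rmult_le_compat; [apply Cmod_ge_0 | apply Cmod_ge_0 | apply IH | apply Hf] |].
    set (P := Cmod (rising (RtoC x) (S n))); set (Q := Cmod (RtoC x + RtoC (INR (S n)))%C).
    match goal with |- P * exp ?u * (Q * exp ?v) <= _ =>
      replace (P * exp u * (Q * exp v)) with (P * Q * exp (u + v)) by (rewrite exp_plus; ring) end.
    apply Rmult_le_compat_l; [apply Rmult_le_pos; apply Cmod_ge_0 |].
    apply exp_le; rewrite <- Rmult_plus_distr_l.
    apply Rmult_le_compat_l; [pose proof (pow2_ge_0 y); lra |].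
    rewrite S_INR; pose proof (pos_INR n).
    assert (H1 : / (x + (INR n + 1)) ^ 2 <= / (x + INR n) - / (x + (INR n + 1))).
    { replace (/ (x + INR n) - / (x + (INR n + 1))) with
        (/ ((x + INR n) * (x + (INR n + 1)))) by (field; lra).
      apply Rinv_le_contravar; nra. }
    lra.
Qed.

Lemma Clim_norm_le (u v : nat -> C) (l m : C) K :
  Clim u l -> Clim v m -> (forall n, Cmod (u n) <= K * Cmod (v n)) ->
  Cmod l <= K * Cmod m.
Proof.
  intros Hu Hv H.
  assert (L : forall w z, Clim w z -> is_lim_seq (fun n => Cmod (w n)) (Cmod z)).
  { intros w z Hw; rewrite <- norm_Cmod.
    apply (is_lim_seq_ext (fun n => norm (V := C_R_NormedModule) (w n))).
    - intros; apply norm_Cmod.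
    - eapply filterlim_comp; [exact Hw | apply (filterlim_norm (V := C_R_NormedModule))]. }
  apply (is_lim_seq_le (fun n => Cmod (u n)) (fun n => K * Cmod (v n)) (Cmod l) (K * Cmod m) H).
  - apply L, Hu.
  - apply (is_lim_seq_scal_l (fun n => Cmod (v n)) K (Cmod m)), L, Hv.
Qed.

(** The factors of Gauss's product at s and at Re s are compared one by one. In a sector
    |Im s| <= c Re s the bound grows only exponentially in Re s. *)
Lemma rGamma_imag_bound (s : C) : 0 < Re s ->
  Cmod (rGamma s) * GammaR (Re s) <= exp (Im s ^ 2 / 2 * (/ Re s ^ 2 + / Re s)).
Proof.
  intros Hs; destruct (rGamma_RtoC (Re s) Hs) as [E HG].
  set (e := exp _).
  assert (H : Cmod (rGamma s) <= e * Cmod (rGamma (RtoC (Re s)))).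
  { apply (Clim_norm_le (gauss_quotient s) (gauss_quotient (RtoC (Re s)))); try apply rGamma_correct.
    intros n; unfold gauss_quotient.
    assert (Hz : forall w, (RtoC (INR (fact n)) * Rcpow (INR n) w <> 0)%C).
    { intros w; apply Cmult_neq_0; [apply fact_neq_0_C | apply Rcpow_neq_0]. }
    rewrite !Cmod_div by apply Hz; rewrite !Cmod_mult, !Cmod_Rcpow.
    cbn [Re RtoC fst].
    unfold Rdiv; rewrite <- Rmult_assoc; apply Rmult_le_compat_r.
    - apply Rlt_le, Rinv_0_lt_compat, Rmult_lt_0_compat; [| apply Rpower_pos].
      apply Cmod_gt_0, fact_neq_0_C.
    - eapply Rle_trans; [apply rising_le, Hs |].
      rewrite Rmult_comm; apply Rmult_le_compat_r; [apply Cmod_ge_0 |].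
      apply exp_le, Rmult_le_compat_l; [pose proof (pow2_ge_0 (Im s)); lra |].
      pose proof (pos_INR n).
      assert (0 < / (Re s + INR n)) by (apply Rinv_0_lt_compat; lra); lra. }
  rewrite E, Cmod_R, Rabs_pos_eq in H by (apply Rlt_le, Rinv_0_lt_compat, HG).
  apply Rmult_le_compat_r with (r := GammaR (Re s)) in H; [| lra].
  rewrite Rmult_assoc, Rinv_l, Rmult_1_r in H by lra; exact H.
Qed.

Lemma Re_le_Cmod (z : C) : - Cmod z <= Re z <= Cmod z.
Proof.
  pose proof (re_le_Cmod z) as H; unfold Rabs in H; destruct Rcase_abs; lra.
Qed.

Lemma Im_le_Cmod (z : C) : Rabs (Im z) <= Cmod z.
Proof.
  eapply Rle_trans; [| apply Rmax_Cmod]; apply Rmax_r.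
Qed.

(** Far along the ray, b enters only as a bounded perturbation, uniformly for b near b0. *)
Lemma ray_in_sector (a b0 : C) : 0 < Re a -> exists c k0, 0 < c /\
  forall k b, (k0 <= k)%nat -> Cmod (b - b0)%C <= 1 ->
    let s := (b + a * RtoC (INR k))%C in
    1 <= Re s /\ Rabs (Im s) <= c * Re s /\
    Re a * INR k - (Cmod b0 + 1) <= Re s <= Re a * INR k + (Cmod b0 + 1).
Proof.
  intros Ha.
  exists ((Re a + 2 * Cmod a) / Re a).
  (* beyond this rank, |b| + 1 is at most half of Re a * k *)
  destruct (nfloor_ex (2 * (Cmod b0 + 2) / Re a)) as [N [_ HN]].
  { pose proof (Cmod_ge_0 b0); apply Rlt_le, Rdiv_lt_0_compat; lra. }
  exists (S N); pose proof (Cmod_ge_0 a); pose proof (Cmod_ge_0 b0).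
  split; [apply Rdiv_lt_0_compat; lra |].
  intros k b Hk Hb s.
  assert (Hk1 : INR N + 1 <= INR k) by (rewrite <- S_INR; apply le_INR, Hk).
  assert (Hk2 : 2 * (Cmod b0 + 2) <= Re a * INR k).
  { apply Rmult_le_reg_r with (/ Re a); [apply Rinv_0_lt_compat, Ha |].
    replace (Re a * INR k * / Re a) with (INR k) by (field; lra).
    unfold Rdiv in HN; lra. }
  assert (Hb2 : Cmod b <= Cmod b0 + 1).
  { replace b with ((b - b0) + b0)%C by ring.
    eapply Rle_trans; [apply Cmod_triangle | lra]. }
  assert (Er : Re s = Re b + Re a * INR k) by (unfold s; rewrite Re_plus, Re_mult_R; reflexivity).
  assert (Ei : Im s = Im b + Im a * INR k) by (unfold s; rewrite Im_plus, Im_mult_R; reflexivity).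
  pose proof (Re_le_Cmod b); pose proof (Im_le_Cmod b); pose proof (Im_le_Cmod a).
  split; [lra | split; [| lra]].
  apply Rle_trans with ((Re a + 2 * Cmod a) / Re a * (Re a * INR k / 2)).
  - replace ((Re a + 2 * Cmod a) / Re a * (Re a * INR k / 2)) with
      (Re a * INR k / 2 + Cmod a * INR k) by (field; lra).
    rewrite Ei; eapply Rle_trans; [apply Rabs_triang |].
    rewrite Rabs_mult, (Rabs_pos_eq (INR k)) by apply pos_INR.
    pose proof (pos_INR k).
    assert (Rabs (Im a) * INR k <= Cmod a * INR k) by (apply Rmult_le_compat_r; lra).
    lra.
  - apply Rmult_le_compat_l; [apply Rlt_le, Rdiv_lt_0_compat; lra |].
    rewrite Er; lra.
Qed.

Lemma exp_mult_INR x n : exp (x * INR n) = exp x ^ n.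
Proof.
  induction n as [| n IH]; [cbn; rewrite Rmult_0_r; apply exp_0 |].
  rewrite S_INR, Rmult_plus_distr_l, exp_plus, IH, Rmult_1_r; cbn [pow]; ring.
Qed.

Lemma Rpower_mult_INR t x n : Rpower t (x * INR n) = Rpower t x ^ n.
Proof.
  unfold Rpower; rewrite <- exp_mult_INR; f_equal; ring.
Qed.

Lemma rGamma_GammaR_growth (a b0 : C) : 0 < Re a -> exists A D k0, 0 < A /\ 0 < D /\
  forall k b, (k0 <= k)%nat -> Cmod (b - b0)%C <= 1 ->
    let s := (b + a * RtoC (INR k))%C in
    1 <= Re s /\ Re a * INR k - (Cmod b0 + 1) <= Re s /\
    Cmod (rGamma s) * GammaR (Re s) <= A * D ^ k.
Proof.
  intros Ha; destruct (ray_in_sector a b0 Ha) as (c & k0 & Hc & H).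
  exists (exp (c ^ 2 / 2 * (Cmod b0 + 2))), (exp (c ^ 2 / 2 * Re a)), k0.
  split; [apply exp_pos | split; [apply exp_pos |]].
  intros k b Hk Hb s; destruct (H k b Hk Hb) as (H1 & H2 & H3 & H4); fold s in H1, H2, H3, H4.
  split; [exact H1 | split; [exact H3 |]].
  eapply Rle_trans; [apply rGamma_imag_bound; lra |].
  rewrite <- exp_mult_INR, <- exp_plus; apply exp_le.
  assert (E : Im s ^ 2 <= c ^ 2 * Re s ^ 2).
  { rewrite <- pow2_abs; replace (c ^ 2 * Re s ^ 2) with ((c * Re s) ^ 2) by ring.
    apply pow_incr; split; [apply Rabs_pos | exact H2]. }
  apply Rle_trans with (c ^ 2 * Re s ^ 2 / 2 * (/ Re s ^ 2 + / Re s)).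
  - apply Rmult_le_compat_r; [| lra].
    assert (0 < / Re s ^ 2) by (apply Rinv_0_lt_compat, pow_lt; lra).
    assert (0 < / Re s) by (apply Rinv_0_lt_compat; lra); lra.
  - replace (c ^ 2 * Re s ^ 2 / 2 * (/ Re s ^ 2 + / Re s)) with (c ^ 2 / 2 * (1 + Re s))
      by (field; lra).
    replace (c ^ 2 / 2 * (Cmod b0 + 2) + c ^ 2 / 2 * Re a * INR k) with
      (c ^ 2 / 2 * (Cmod b0 + 2 + Re a * INR k)) by ring.
    apply Rmult_le_compat_l; [pose proof (pow2_ge_0 c); lra | lra].
Qed.

(** Gamma outgrows every geometric sequence: M is chosen so that M^(Re a) exceeds twice the
    product of q and of the exponential rate of the sector bound. *)
Lemma rGamma_decay (a b0 : C) q : 0 < Re a -> 0 <= q -> exists A k0, 0 <= A /\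
  forall k b, (k0 <= k)%nat -> Cmod (b - b0)%C <= 1 ->
    q ^ k * Cmod (rGamma (b + a * RtoC (INR k))%C) <= A * (1 / 2) ^ k.
Proof.
  intros Ha Hq; destruct (rGamma_GammaR_growth a b0 Ha) as (A & D & k0 & HA & HD & H).
  (* M ^ Re a = B >= 2 q D *)
  set (B := 2 * q * D + 1); set (M := Rpower B (/ Re a)).
  assert (HB : 1 <= B) by (unfold B; nra).
  assert (HlnB : 0 <= ln B) by (rewrite <- ln_1; apply ln_le; lra).
  assert (HlnM : ln M = / Re a * ln B) by apply ln_exp.
  assert (HM0 : 0 < M) by apply exp_pos.
  assert (HlnM0 : 0 <= ln M).
  { rewrite HlnM; apply Rmult_le_pos; [apply Rlt_le, Rinv_0_lt_compat, Ha | exact HlnB]. }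
  exists (A * exp (M + 1) * Rpower M (Cmod b0 + 2)), k0; split.
  { repeat apply Rmult_le_pos; try lra; apply Rlt_le, exp_pos. }
  intros k b Hk Hb; destruct (H k b Hk Hb) as (H1 & H2 & H3).
  set (s := (b + a * RtoC (INR k))%C) in *.
  pose proof (GammaR_lower (Re s) M H1 HM0) as HL.
  assert (HMx : Rpower M (Re s - 1) * Rpower M (Cmod b0 + 2) >= B ^ k).
  { rewrite <- Rpower_plus; unfold Rpower.
    rewrite <- (exp_ln B) at 1 by lra; rewrite <- exp_mult_INR; apply Rle_ge, exp_le.
    apply Rle_trans with (Re a * INR k * ln M).
    - rewrite HlnM; right; field; lra.
    - apply Rmult_le_compat_r; [exact HlnM0 | lra]. }
  set (R := Cmod (rGamma s)) in *.
  assert (HR : 0 <= R) by apply Cmod_ge_0.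
  set (U := Rpower M (Re s - 1)) in *; set (V := Rpower M (Cmod b0 + 2)) in *.
  assert (HV : 0 < V) by apply exp_pos.
  assert (Hee : exp (- (M + 1)) * exp (M + 1) = 1).
  { rewrite <- exp_plus; replace (- (M + 1) + (M + 1)) with 0 by ring; apply exp_0. }
  pose proof (exp_pos (M + 1)) as He.
  assert (H4 : R * U <= A * D ^ k * exp (M + 1)).
  { apply Rle_trans with (R * (U * exp (- (M + 1))) * exp (M + 1)).
    - right; transitivity (R * U * (exp (- (M + 1)) * exp (M + 1))); [rewrite Hee; ring | ring].
    - apply Rmult_le_compat_r; [lra |]. eapply Rle_trans; [| exact H3].
      apply Rmult_le_compat_l; assumption. }
  assert (H5 : R * B ^ k <= A * D ^ k * exp (M + 1) * V).
  { apply Rle_trans with (R * (U * V)).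
    - apply Rmult_le_compat_l; [exact HR | lra].
    - rewrite <- Rmult_assoc; apply Rmult_le_compat_r; lra. }
  assert (HBk : (2 * q * D) ^ k <= B ^ k).
  { apply pow_incr; split; [| unfold B; lra].
    apply Rmult_le_pos; [lra | lra]. }
  assert (HDk : 0 < D ^ k) by (apply pow_lt, HD).
  assert (H2k : 0 < 2 ^ k) by (apply pow_lt; lra).
  replace ((1 / 2) ^ k) with (/ 2 ^ k).
  2:{ rewrite <- pow_inv; f_equal; field. }
  apply Rmult_le_reg_r with (2 ^ k * D ^ k); [apply Rmult_lt_0_compat; assumption |].
  replace (q ^ k * R * (2 ^ k * D ^ k)) with (R * (2 * q * D) ^ k)
    by (rewrite !Rpow_mult_distr; ring).
  apply Rle_trans with (R * B ^ k); [apply Rmult_le_compat_l; assumption |].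
  eapply Rle_trans; [exact H5 | right; field; lra].
Qed.

Lemma ex_series_geom_half A : ex_series (fun k => A * (1 / 2) ^ k).
Proof.
  apply (ex_series_scal_l A (fun k => (1 / 2) ^ k)), ex_series_geom.
  rewrite Rabs_pos_eq; lra.
Qed.

Lemma ex_series_eventually_le (u v : nat -> R) N :
  (forall k, (N <= k)%nat -> 0 <= u k <= v k) -> ex_series v -> ex_series u.
Proof.
  intros H Hv; apply (ex_series_incr_n u N).
  apply (ex_series_le (V := R_CompleteNormedModule)) with (fun k => v (N + k)%nat).
  - intros k; change (Rabs (u (N + k)%nat) <= v (N + k)%nat).
    specialize (H (N + k)%nat ltac:(lia)); rewrite Rabs_pos_eq; lra.
  - apply (ex_series_incr_n v N), Hv.
Qed.

Lemma Cmod_minus_diag (b : C) : Cmod (b - b)%C <= 1.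
Proof. replace (b - b)%C with (RtoC 0) by ring; rewrite Cmod_0; lra. Qed.

Lemma ex_series_rGamma (a b : C) q : 0 < Re a -> 0 <= q ->
  ex_series (fun k => q ^ k * Cmod (rGamma (b + a * RtoC (INR k))%C)).
Proof.
  intros Ha Hq; destruct (rGamma_decay a b q Ha Hq) as (A & k0 & _ & H).
  apply ex_series_eventually_le with (fun k => A * (1 / 2) ^ k) k0; [| apply ex_series_geom_half].
  intros k Hk; split.
  - apply Rmult_le_pos; [apply pow_le, Hq | apply Cmod_ge_0].
  - apply H; [exact Hk | apply Cmod_minus_diag].
Qed.

Lemma mittag_leffler_correct (a b w : C) : 0 < Re a ->
  is_series (V := C_R_NormedModule)
    (fun k => w ^ k * rGamma (b + a * RtoC (INR k)))%C (mittag_leffler a b w).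
Proof.
  intros Ha.
  assert (H : ex_series (V := C_R_NormedModule)
    (fun k => w ^ k * rGamma (b + a * RtoC (INR k)))%C).
  { apply (ex_series_le (V := C_R_CompleteNormedModule)) with
      (fun k => Cmod w ^ k * Cmod (rGamma (b + a * RtoC (INR k))%C)).
    - intros k; rewrite norm_Cmod, Cmod_mult, Cmod_pow; lra.
    - apply ex_series_rGamma; [exact Ha | apply Cmod_ge_0]. }
  destruct H as [l Hl].
  enough (E : mittag_leffler a b w = l) by (rewrite E; exact Hl).
  apply (iota_filterlim_locally (V := C_R_CompleteNormedModule) _ _ Hl).
Qed.

(** * Continuity in the second parameter *)

Lemma exp_le_plus_inv t y : 0 < t -> Rabs y <= Rabs (ln t) -> exp y <= t + / t.
Proof.
  intros Ht Hy; pose proof (Rinv_0_lt_compat t Ht).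
  assert (H1 : y <= ln t \/ y <= - ln t).
  { pose proof (Rle_abs y); unfold Rabs at 2 in Hy; destruct Rcase_abs; [right | left]; lra. }
  destruct H1 as [H1 | H1]; apply exp_le in H1.
  - rewrite exp_ln in H1 by exact Ht; lra.
  - rewrite exp_Ropp, exp_ln in H1 by exact Ht; lra.
Qed.

(** On the unit disc around s0, |t^(s-s0) - 1| <= 2 |s - s0| (t + 1/t)^2, and the square
    only shifts the real part of the exponent by at most 2. *)
Lemma euler_kernel_lipschitz (s s0 : C) t : 0 < t -> Cmod (s - s0)%C <= 1 ->
  Cmod (euler_kernel s t - euler_kernel s0 t)%C <= Cmod (s - s0)%C *
    (2 * (euler_kernelR (Re s0 + 2) t + 2 * euler_kernelR (Re s0) t + euler_kernelR (Re s0 - 2) t)).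
Proof.
  intros Ht Hs.
  set (d := (s - s0)%C) in *.
  replace (euler_kernel s t - euler_kernel s0 t)%C with (euler_kernel s0 t * (Rcpow t d - 1))%C.
  2:{ unfold euler_kernel; replace (s - 1)%C with ((s0 - 1) + d)%C by (unfold d; ring).
      rewrite Rcpow_plus; ring. }
  rewrite Cmod_mult, Cmod_euler_kernel.
  assert (H1 : Cmod (Rcpow t d - 1)%C <= Cmod d * (2 * (t + / t) ^ 2)).
  { unfold Rcpow; eapply Rle_trans; [apply Cexp_minus_1_le |].
    rewrite Cmod_mult, Cmod_R, Re_mult_R, Rmult_assoc.
    apply Rmult_le_compat_l; [apply Cmod_ge_0 |].
    assert (Hl : Rabs (ln t) <= t + / t).
    { eapply Rle_trans; [| apply (exp_le_plus_inv t (Rabs (ln t))); [exact Ht | rewrite Rabs_Rabsolu; lra]].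
      pose proof (exp_ineq1_le (Rabs (ln t))); lra. }
    assert (H1 : 1 <= t + / t).
    { rewrite <- exp_0; apply exp_le_plus_inv; [exact Ht | rewrite Rabs_R0; apply Rabs_pos]. }
    assert (He : exp (Re d * ln t) <= t + / t).
    { apply exp_le_plus_inv; [exact Ht |]; rewrite Rabs_mult.
      rewrite <- (Rmult_1_l (Rabs (ln t))) at 2.
      apply Rmult_le_compat_r; [apply Rabs_pos |].
      eapply Rle_trans; [apply re_le_Cmod | exact Hs]. }
    replace (2 * (t + / t) ^ 2) with ((t + / t) * (2 * (t + / t))) by ring.
    apply Rmult_le_compat; [apply Rabs_pos | pose proof (exp_pos (Re d * ln t)); lra | exact Hl | lra]. }
  replace (euler_kernelR (Re s0 + 2) t) with (euler_kernelR (Re s0) t * t * t).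
  2:{ rewrite <- !euler_kernelR_succ by exact Ht; f_equal; ring. }
  replace (euler_kernelR (Re s0) t) with (euler_kernelR (Re s0 - 2) t * t * t).
  2:{ rewrite <- !euler_kernelR_succ by exact Ht; f_equal; ring. }
  set (k := euler_kernelR (Re s0 - 2) t).
  assert (Hk : 0 < k) by apply euler_kernelR_pos. clearbody k.
  eapply Rle_trans; [apply Rmult_le_compat_l; [| exact H1] |].
  - repeat apply Rmult_le_pos; lra.
  - right; field; lra.
Qed.

Lemma GammaC_lipschitz (s0 : C) : 3 <= Re s0 -> exists L, 0 <= L /\ forall s,
  Cmod (s - s0)%C <= 1 -> Cmod (GammaC s - GammaC s0)%C <= L * Cmod (s - s0)%C.
Proof.
  intros Hs0.
  exists (2 * (GammaR (Re s0 + 2) + 2 * GammaR (Re s0) + GammaR (Re s0 - 2))).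
  split.
  { pose proof (proj2 (rGamma_RtoC (Re s0 + 2) ltac:(lra))).
    pose proof (proj2 (rGamma_RtoC (Re s0) ltac:(lra))).
    pose proof (proj2 (rGamma_RtoC (Re s0 - 2) ltac:(lra))); lra. }
  intros s Hs.
  assert (Hr : 2 <= Re s).
  { pose proof (Re_le_Cmod (s - s0)%C) as H; rewrite Re_minus in H; lra. }
  rewrite (Rmult_comm _ (Cmod _)), <- norm_Cmod.
  apply (ImpInt_norm_le (V := C_R_CompleteNormedModule)
    (fun t => minus (G := C_R_NormedModule) (euler_kernel s t) (euler_kernel s0 t))
    (fun t => Cmod (s - s0)%C *
    (2 * (euler_kernelR (Re s0 + 2) t + 2 * euler_kernelR (Re s0) t + euler_kernelR (Re s0 - 2) t)))).
  - intros t Ht; rewrite norm_Cmod; apply euler_kernel_lipschitz; assumption.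
  - apply (is_RInt_gen_minus (V := C_R_NormedModule)); apply GammaC_correct; lra.
  - apply (is_RInt_gen_scal (V := R_NormedModule)), (is_RInt_gen_scal (V := R_NormedModule)).
    apply (is_RInt_gen_plus (V := R_NormedModule)); [| apply GammaR_correct; lra].
    apply (is_RInt_gen_plus (V := R_NormedModule)); [apply GammaR_correct; lra |].
    apply (is_RInt_gen_scal (V := R_NormedModule)), GammaR_correct; lra.
Qed.

Lemma rGamma_bounded (s : C) : 1 <= Re s -> Cmod (rGamma s) <= exp 2 * exp (Im s ^ 2).
Proof.
  intros Hs.
  pose proof (GammaR_lower (Re s) 1 Hs ltac:(lra)) as HL.
  replace (Rpower 1 (Re s - 1)) with 1 in HL.
  2:{ unfold Rpower; rewrite ln_1, Rmult_0_r, exp_0; reflexivity. }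
  replace (1 + 1) with 2 in HL by ring; rewrite Rmult_1_l in HL.
  pose proof (rGamma_imag_bound s ltac:(lra)) as HI.
  assert (H1 : exp (Im s ^ 2 / 2 * (/ Re s ^ 2 + / Re s)) <= exp (Im s ^ 2)).
  { apply exp_le.
    assert (/ Re s <= 1) by (rewrite <- Rinv_1; apply Rinv_le_contravar; lra).
    assert (/ Re s ^ 2 <= 1) by (rewrite <- Rinv_1; apply Rinv_le_contravar; nra).
    pose proof (pow2_ge_0 (Im s)); nra. }
  assert (Hee : exp (- (2)) * exp 2 = 1).
  { rewrite <- exp_plus; replace (- (2) + 2) with 0 by ring; apply exp_0. }
  pose proof (exp_pos 2); pose proof (Cmod_ge_0 (rGamma s)).
  apply Rle_trans with (Cmod (rGamma s) * GammaR (Re s) * exp 2).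
  - rewrite Rmult_assoc; rewrite <- (Rmult_1_r (Cmod (rGamma s))) at 1.
    apply Rmult_le_compat_l; [lra |]; rewrite <- Hee.
    apply Rmult_le_compat_r; lra.
  - rewrite Rmult_comm; apply Rmult_le_compat_l; lra.
Qed.

Lemma continuous_of_lipschitz_at (F : C -> C) (s0 : C) L : 0 <= L ->
  (forall s, Cmod (s - s0)%C <= 1 -> Cmod (F s - F s0)%C <= L * Cmod (s - s0)%C) ->
  filterlim F (locally (T := C_R_NormedModule) s0) (locally (T := C_R_NormedModule) (F s0)).
Proof.
  intros HL H.
  pose proof (filterlim_id _ (locally (T := C_R_NormedModule) s0)) as Hid.
  apply filterlim_C_le with (fun s => L * Cmod (s - s0)%C); [apply _ | |].
  - generalize (proj1 (filterlim_C (locally (T := C_R_NormedModule) s0) _ s0) Hid 1 Rlt_0_1).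
    apply filter_imp; intros s Hs; apply H; lra.
  - replace (locally 0) with (locally (L * 0)) by (f_equal; ring).
    apply filterlim_R_mult; [apply _ | apply filterlim_const |].
    apply (filterlim_C_norm (locally (T := C_R_NormedModule) s0) _ s0 Hid).
Qed.

(** The difference of the reciprocals is a product of two bounded values of rGamma and of the
    difference of the Euler integrals. *)
Lemma rGamma_continuous_right (s0 : C) : 3 <= Re s0 ->
  filterlim rGamma (locally (T := C_R_NormedModule) s0)
    (locally (T := C_R_NormedModule) (rGamma s0)).
Proof.
  intros Hs0; destruct (GammaC_lipschitz s0 Hs0) as (L & HL & H).
  set (B := exp 2 * exp ((Rabs (Im s0) + 1) ^ 2)).
  assert (HB : 0 < B) by (apply Rmult_lt_0_compat; apply exp_pos).
  apply (continuous_of_lipschitz_at rGamma s0 (B * B * L)).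
  { apply Rmult_le_pos; [apply Rlt_le, Rmult_lt_0_compat; exact HB | exact HL]. }
  intros s Hs.
  assert (Hb : forall w, Cmod (w - s0)%C <= 1 -> Cmod (rGamma w) <= B /\ 0 < Re w).
  { intros w Hw.
    assert (2 <= Re w).
    { pose proof (Re_le_Cmod (w - s0)%C) as H1; rewrite Re_minus in H1; lra. }
    split; [| lra].
    eapply Rle_trans; [apply rGamma_bounded; lra |].
    apply Rmult_le_compat_l; [apply Rlt_le, exp_pos |].
    apply exp_le; rewrite <- pow2_abs; apply pow_incr; split; [apply Rabs_pos |].
    pose proof (Im_le_Cmod (w - s0)%C) as H2.
    replace (Im w) with (Im s0 + Im (w - s0)%C) by (cbn; unfold Im; ring).
    eapply Rle_trans; [apply Rabs_triang | lra]. }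
  destruct (Hb s Hs) as [B1 P1]; destruct (Hb s0 (Cmod_minus_diag s0)) as [B2 P2].
  pose proof (rGamma_GammaC s P1) as E1; pose proof (rGamma_GammaC s0 P2) as E2.
  replace (rGamma s - rGamma s0)%C with
    (rGamma s * rGamma s0 * (- (GammaC s - GammaC s0)))%C.
  2:{ transitivity (rGamma s * (rGamma s0 * GammaC s0) - (rGamma s * GammaC s) * rGamma s0)%C;
      [ring | rewrite E1, E2; ring]. }
  rewrite !Cmod_mult, Cmod_opp, (Rmult_assoc (B * B)).
  apply Rmult_le_compat; try apply Cmod_ge_0; [apply Rmult_le_pos; apply Cmod_ge_0 | | apply H, Hs].
  apply Rmult_le_compat; try apply Cmod_ge_0; assumption.
Qed.

Lemma filterlim_C_translate (s0 c : C) :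
  filterlim (fun s => s + c)%C (locally (T := C_R_NormedModule) s0)
    (locally (T := C_R_NormedModule) (s0 + c)%C).
Proof.
  apply (filterlim_C_plus (locally (T := C_R_NormedModule) s0));
    [apply filterlim_id | apply filterlim_const].
Qed.

(** The functional equation moves continuity to the left, one unit strip at a time. *)
Lemma rGamma_continuous_shift N : forall s0 : C, 3 - INR N <= Re s0 ->
  filterlim rGamma (locally (T := C_R_NormedModule) s0)
    (locally (T := C_R_NormedModule) (rGamma s0)).
Proof.
  induction N as [| N IH]; intros s0 Hs0.
  - apply rGamma_continuous_right; cbn in Hs0; lra.
  - rewrite S_INR in Hs0; rewrite (rGamma_succ s0).
    apply (filterlim_ext (fun s => s * rGamma (s + 1))%C);
      [intros s; symmetry; apply rGamma_succ |].
    apply (filterlim_C_mult (locally (T := C_R_NormedModule) s0)); [apply filterlim_id |].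
    apply (filterlim_comp _ _ _ (fun s => s + 1)%C rGamma _ (locally (T := C_R_NormedModule) (s0 + 1)%C)).
    + apply filterlim_C_translate.
    + apply IH; rewrite Re_plus; cbn; lra.
Qed.

Lemma rGamma_continuous (s0 : C) :
  filterlim rGamma (locally (T := C_R_NormedModule) s0)
    (locally (T := C_R_NormedModule) (rGamma s0)).
Proof.
  destruct (nfloor_ex (Rabs (3 - Re s0))) as [N [_ HN]]; [apply Rabs_pos |].
  apply rGamma_continuous_shift with (S N); rewrite S_INR.
  pose proof (Rle_abs (3 - Re s0)); lra.
Qed.

(** The tails of the series are small uniformly for b within distance 1 of b0, and each term
    is continuous in b. *)
Lemma mittag_leffler_continuous (a b0 w : C) : 0 < Re a ->
  filterlim (fun b => mittag_leffler a b w) (locally (T := C_R_NormedModule) b0)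
    (locally (T := C_R_NormedModule) (mittag_leffler a b0 w)).
Proof.
  intros Ha.
  set (u := fun b k => (w ^ k * rGamma (b + a * RtoC (INR k)))%C).
  assert (Hsum : forall n, filterlim (fun b => sum_n (G := C_R_NormedModule) (u b) n)
    (locally (T := C_R_NormedModule) b0)
    (locally (T := C_R_NormedModule) (sum_n (G := C_R_NormedModule) (u b0) n))).
  { assert (Hterm : forall k, filterlim (fun b => u b k) (locally (T := C_R_NormedModule) b0)
      (locally (T := C_R_NormedModule) (u b0 k))).
    { intros k; unfold u.
      apply (filterlim_C_mult (locally (T := C_R_NormedModule) b0)); [apply filterlim_const |].
      apply (filterlim_comp _ _ _ (fun s => s + a * RtoC (INR k))%C rGamma _
        (locally (T := C_R_NormedModule) (b0 + a * RtoC (INR k))%C)).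
      - apply filterlim_C_translate.
      - apply rGamma_continuous. }
    induction n as [| n IH].
    - rewrite sum_O; apply (filterlim_ext (fun b => u b O)); [| apply Hterm].
      intros b; rewrite sum_O; reflexivity.
    - rewrite sum_Sn.
      apply (filterlim_ext (fun b => sum_n (G := C_R_NormedModule) (u b) n + u b (S n))%C).
      + intros b; rewrite sum_Sn; reflexivity.
      + apply (filterlim_C_plus (locally (T := C_R_NormedModule) b0)); [exact IH | apply Hterm]. }
  destruct (rGamma_decay a b0 (Cmod w) Ha (Cmod_ge_0 w)) as (A & k0 & HA & Hdec).
  destruct (ex_series_geom_half A) as [m Hm].
  apply filterlim_C; [apply _ |]; intros eps He.
  destruct (series_tail_small _ m (eps / 3) Hm ltac:(lra)) as [N HN].
  set (n := max N k0).
  assert (Htail : forall b, Cmod (b - b0)%C <= 1 ->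
    Cmod (mittag_leffler a b w - sum_n (G := C_R_NormedModule) (u b) n)%C < eps / 3).
  { intros b Hb; eapply Rle_lt_trans; [| apply (HN n); unfold n; lia].
    apply series_tail_le; [apply mittag_leffler_correct, Ha | exact Hm | |].
    - intros k; apply Rmult_le_pos; [exact HA | apply pow_le; lra].
    - intros k Hk; unfold u; rewrite Cmod_mult, Cmod_pow; apply Hdec; [unfold n in Hk; lia | exact Hb]. }
  pose proof (filterlim_id _ (locally (T := C_R_NormedModule) b0)) as Hid.
  pose proof (proj1 (filterlim_C (locally (T := C_R_NormedModule) b0) _ b0) Hid 1 Rlt_0_1) as H1.
  pose proof (proj1 (filterlim_C (locally (T := C_R_NormedModule) b0) _ _) (Hsum n) (eps / 3) ltac:(lra)) as H2.
  generalize (filter_and _ _ H1 H2); apply filter_imp; intros b [Hb Hs].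
  pose proof (Htail b (Rlt_le _ _ Hb)) as T1; pose proof (Htail b0 (Cmod_minus_diag b0)) as T2.
  set (s1 := sum_n (G := C_R_NormedModule) (u b) n) in *.
  set (s2 := sum_n (G := C_R_NormedModule) (u b0) n) in *.
  replace (mittag_leffler a b w - mittag_leffler a b0 w)%C with
    ((mittag_leffler a b w - s1) + ((s1 - s2) + - (mittag_leffler a b0 w - s2)))%C by ring.
  eapply Rle_lt_trans; [apply Cmod_triangle |].
  pose proof (Cmod_triangle (s1 - s2)%C (- (mittag_leffler a b0 w - s2))%C) as H4.
  rewrite Cmod_opp in H4; lra.
Qed.

(** * Termwise integration of the Mittag-Leffler integrand *)

Lemma is_series_Cmult (u : nat -> C) (l c : C) :
  is_series (V := C_R_NormedModule) u l ->
  is_series (V := C_R_NormedModule) (fun k => c * u k)%C (c * l)%C.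
Proof.
  intros H.
  apply (filterlim_ext (fun n => c * sum_n (G := C_R_NormedModule) u n)%C).
  - intros n; induction n as [| n IH].
    + rewrite !sum_O; reflexivity.
    + rewrite !sum_Sn, <- IH.
      change plus with Cplus; apply Cmult_plus_distr_l.
  - apply (filterlim_C_mult eventually); [apply filterlim_const | exact H].
Qed.

Section Subordination.

Variables (a z b c beta K : C).
Hypothesis Ha : 0 < Re a.
Hypothesis Hc : 0 < Re c.
Hypothesis Hdup : forall w : C,
  (rGamma (beta + RtoC 2 * w) = K * Rcpow 2 (- (RtoC 2 * w)) * (rGamma (b + w) * rGamma (c + w)))%C.

Let coef (k : nat) : C := ((- z) ^ k * Rcpow 4 (a * RtoC (INR k))
  * rGamma (beta + RtoC 2 * a * RtoC (INR k)))%C.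

Let integrand (t : R) : C := (Rcpow t (c - 1) * RtoC (exp (- t))
  * mittag_leffler (RtoC 2 * a) beta (- z * Rcpow (4 * t) a))%C.

Lemma Re_c_ak k : Re (c + a * RtoC (INR k))%C = Re c + Re a * INR k.
Proof. rewrite Re_plus, Re_mult_R; reflexivity. Qed.

Lemma Re_c_ak_pos k : 0 < Re (c + a * RtoC (INR k))%C.
Proof.
  rewrite Re_c_ak; pose proof (pos_INR k).
  assert (0 <= Re a * INR k) by (apply Rmult_le_pos; lra); lra.
Qed.

Lemma Rcpow_4_2 (w : C) : (Rcpow 4 w * Rcpow 2 (- (RtoC 2 * w)) = 1)%C.
Proof.
  unfold Rcpow; rewrite <- Cexp_plus.
  replace (ln 4) with (2 * ln 2).
  - replace (_ + _)%C with (RtoC 0); [apply Cexp_0 | rewrite RtoC_mult; ring].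
  - replace 4 with (2 * 2) by ring; rewrite ln_mult by lra; ring.
Qed.

Lemma coef_split k : coef k = (K * ((- z) ^ k *
  (rGamma (b + a * RtoC (INR k)) * rGamma (c + a * RtoC (INR k)))))%C.
Proof.
  unfold coef.
  replace (RtoC 2 * a * RtoC (INR k))%C with (RtoC 2 * (a * RtoC (INR k)))%C by ring.
  rewrite Hdup.
  set (w := (a * RtoC (INR k))%C).
  transitivity (K * ((- z) ^ k * (rGamma (b + w) * rGamma (c + w)))
    * (Rcpow 4 w * Rcpow 2 (- (RtoC 2 * w))))%C; [ring |].
  rewrite Rcpow_4_2; ring.
Qed.

(** Integrating the k-th term produces GammaC (c + a k), which cancels one of the two
    reciprocal Gamma factors given by the duplication formula; the powers of 4 and 2 cancel. *)
Lemma coef_GammaC k : (coef k * GammaC (c + a * RtoC (INR k)))%C =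
  (K * ((- z) ^ k * rGamma (b + a * RtoC (INR k))))%C.
Proof.
  rewrite coef_split.
  pose proof (rGamma_GammaC _ (Re_c_ak_pos k)) as E.
  transitivity (K * ((- z) ^ k * rGamma (b + a * RtoC (INR k)))
    * (rGamma (c + a * RtoC (INR k)) * GammaC (c + a * RtoC (INR k))))%C; [ring |].
  rewrite E; ring.
Qed.

(** Absolute integrability: GammaR at the real part does not cancel rGamma (c + a k), but
    their product grows only exponentially, and rGamma (b + a k) decays faster. *)
Lemma ex_series_coef_GammaR :
  ex_series (fun k => Cmod (coef k) * GammaR (Re (c + a * RtoC (INR k))%C)).
Proof.
  destruct (rGamma_GammaR_growth a c Ha) as (A & D & k0 & HA & HD & H).
  apply ex_series_eventually_le with (fun k => Cmod K * A *
    ((Cmod z * D) ^ k * Cmod (rGamma (b + a * RtoC (INR k))%C))) k0.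
  - intros k Hk.
    destruct (H k c Hk (Cmod_minus_diag c)) as (_ & _ & H3).
    pose proof (proj2 (rGamma_RtoC _ (Re_c_ak_pos k))) as HG.
    split; [apply Rmult_le_pos; [apply Cmod_ge_0 | lra] |].
    rewrite coef_split, !Cmod_mult, Cmod_pow, Cmod_opp, Rpow_mult_distr.
    set (X := Cmod z ^ k * Cmod (rGamma (b + a * RtoC (INR k))%C)).
    assert (HX : 0 <= X) by (apply Rmult_le_pos; [apply pow_le |]; apply Cmod_ge_0).
    apply Rle_trans with (Cmod K * X * (A * D ^ k)); [| right; unfold X; ring].
    eapply Rle_trans; [| apply Rmult_le_compat_l; [| exact H3]].
    + right; unfold X; ring.
    + apply Rmult_le_pos; [apply Cmod_ge_0 | exact HX].
  - apply (ex_series_scal_l (V := R_NormedModule)).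
    apply ex_series_rGamma; [exact Ha | apply Rmult_le_pos; [apply Cmod_ge_0 | lra]].
Qed.

Lemma Re_2a : 0 < Re (RtoC 2 * a)%C.
Proof. rewrite Cmult_comm, Re_mult_R; lra. Qed.

Lemma coef_euler_kernel_bound u v : 0 < u <= v -> exists M, ex_series M /\
  forall k t, u <= t <= v -> Cmod (coef k * euler_kernel (c + a * RtoC (INR k)) t)%C <= M k.
Proof.
  intros Huv.
  exists (fun k => Rpower v (Re c) * / u * ((Cmod z * Rpower 4 (Re a) * Rpower v (Re a)) ^ k *
    Cmod (rGamma (beta + RtoC 2 * a * RtoC (INR k))%C))); split.
  - apply (ex_series_scal_l (V := R_NormedModule)), ex_series_rGamma; [apply Re_2a |].
    repeat apply Rmult_le_pos; try apply Cmod_ge_0; apply Rlt_le, Rpower_pos.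
  - intros k t Ht; rewrite Cmod_mult, Cmod_euler_kernel, Re_c_ak.
    set (x := Re c + Re a * INR k).
    assert (Hx : 0 < x) by (unfold x; rewrite <- Re_c_ak; apply Re_c_ak_pos).
    assert (Hg : euler_kernelR x t <= Rpower v x * / u).
    { unfold euler_kernelR; rewrite <- (Rmult_1_r (Rpower v x * / u)).
      apply Rmult_le_compat; try (apply Rlt_le, exp_pos).
      - unfold Rminus; rewrite Rpower_plus, Rpower_Ropp, Rpower_1 by lra.
        apply Rmult_le_compat; [apply Rlt_le, Rpower_pos | apply Rlt_le, Rinv_0_lt_compat; lra | |].
        + apply Rle_Rpower_l; [lra | split; lra].
        + apply Rinv_le_contravar; lra.
      - rewrite <- exp_0; apply exp_le; lra. }
    assert (Ev : Rpower v x = Rpower v (Re c) * Rpower v (Re a) ^ k)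
      by (unfold x; rewrite Rpower_plus, Rpower_mult_INR; reflexivity).
    assert (Ek : Cmod (coef k) = Cmod z ^ k * Rpower 4 (Re a) ^ k *
      Cmod (rGamma (beta + RtoC 2 * a * RtoC (INR k))%C)).
    { unfold coef; rewrite !Cmod_mult, Cmod_pow, Cmod_opp, Cmod_Rcpow, Re_mult_R, Rpower_mult_INR.
      reflexivity. }
    eapply Rle_trans; [apply Rmult_le_compat_l; [apply Cmod_ge_0 | exact Hg] |].
    right; rewrite Ek, Ev, !Rpow_mult_distr; ring.
Qed.

Lemma integrand_series t : 0 < t -> is_series (V := C_R_NormedModule)
  (fun k => coef k * euler_kernel (c + a * RtoC (INR k)) t)%C (integrand t).
Proof.
  intros Ht.
  pose proof (is_series_Cmult _ _ (Rcpow t (c - 1) * RtoC (exp (- t)))%C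
    (mittag_leffler_correct (RtoC 2 * a)%C beta (- z * Rcpow (4 * t) a)%C Re_2a)) as H.
  apply (is_series_ext (V := C_R_NormedModule)) with (2 := H); intros k.
  rewrite Cpow_mult_l, Rcpow_pow, Rcpow_mult_base by lra.
  unfold coef, euler_kernel.
  replace (c + a * RtoC (INR k) - 1)%C with (c - 1 + a * RtoC (INR k))%C by ring.
  rewrite Rcpow_plus; match goal with |- ?x = ?y => change (@eq C x y) end; ring.
Qed.

(** Both representations are instances, with {b, c} = {p, p + 1/2} and beta = 2 p: the
    duplication formula is symmetric in its two factors. *)
Lemma subordination :
  ImpInt (V := C_R_NormedModule) integrand (K * mittag_leffler a b (- z))%C.
Proof.
  apply (ImpInt_series
    (fun k t => coef k * euler_kernel (c + a * RtoC (INR k)) t)%C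
    (fun k t => Cmod (coef k) * euler_kernelR (Re (c + a * RtoC (INR k))%C) t)
    (fun k => coef k * GammaC (c + a * RtoC (INR k)))%C
    (fun k => Cmod (coef k) * GammaR (Re (c + a * RtoC (INR k))%C))).
  - intros k; apply ImpInt_Cmult, GammaC_correct, Re_c_ak_pos.
  - intros k u v Huv; destruct (ex_RInt_euler_kernel (c + a * RtoC (INR k)) u v Huv) as [I HI].
    eexists; apply is_RInt_Cmult, HI.
  - intros k u v Huv; apply (ex_RInt_scal (V := R_NormedModule)), ex_RInt_euler_kernelR, Huv.
  - intros k t Ht; rewrite Cmod_mult, Cmod_euler_kernel; lra.
  - intros k; apply (is_RInt_gen_scal (V := R_NormedModule)), GammaR_correct, Re_c_ak_pos.
  - apply ex_series_coef_GammaR.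
  - apply coef_euler_kernel_bound.
  - apply integrand_series.
  - pose proof (is_series_Cmult _ _ K (mittag_leffler_correct a b (- z)%C Ha)) as H.
    apply (is_series_ext (V := C_R_NormedModule)) with (2 := H).
    intros k; symmetry; apply coef_GammaC.
Qed.

End Subordination.

(** * The two integral representations *)

Lemma RtoC_2 : RtoC 2 = (1 + 1)%C.
Proof. rewrite <- RtoC_plus; reflexivity. Qed.

Lemma sqrt_PI_neq_0 : RtoC (sqrt PI) <> 0.
Proof. apply RtoC_neq_0, Rgt_not_eq, sqrt_lt_R0, PI_RGT_0. Qed.

Lemma duplication_shift (p w : C) :
  (rGamma (RtoC 2 * p + RtoC 2 * w) =
   RtoC 2 * RtoC (sqrt PI) * Rcpow 2 (- (RtoC 2 * p)) * Rcpow 2 (- (RtoC 2 * w))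
   * (rGamma (p + w) * rGamma (p + w + RtoC (1 / 2))))%C.
Proof.
  rewrite rGamma_duplication.
  pose proof sqrt_PI_neq_0; pose proof PI_RGT_0.
  assert (H2 : RtoC 2 <> 0) by (apply RtoC_neq_0; lra).
  assert (E : (Rcpow 2 (- (RtoC 2 * p)) * Rcpow 2 (- (RtoC 2 * w))
     * Rcpow 2 (RtoC 2 * (p + w)) = 1)%C).
  { rewrite <- !Rcpow_plus.
    replace (_ + _)%C with (RtoC 0) by ring; apply Rcpow_0. }
  replace (RtoC 2 * p + RtoC 2 * w)%C with (RtoC 2 * (p + w))%C by ring.
  rewrite !RtoC_inv by (try apply Rgt_not_eq, sqrt_lt_R0; lra).
  transitivity (rGamma (RtoC 2 * (p + w)) * (Rcpow 2 (- (RtoC 2 * p)) *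
    Rcpow 2 (- (RtoC 2 * w)) * Rcpow 2 (RtoC 2 * (p + w))))%C; [rewrite E; ring | field; auto].
Qed.

Lemma ImpInt_CInt (f : R -> C) (l : C) : ImpInt (V := C_R_NormedModule) f l ->
  ex_CInt_0_inf f /\ CInt_0_inf f = l.
Proof.
  intros H; split; [exists l; exact H |].
  unfold CInt_0_inf; exact (is_RInt_gen_unique (V := C_R_CompleteNormedModule) f l H).
Qed.

Lemma mittag_leffler_eq_rhs1 (a z b : C) : 0 < Re a -> - (1 / 2) < Re b ->
  ex_CInt_0_inf (integrand1 a b z) /\ mittag_leffler a b (- z)%C = rhs1 a b z.
Proof.
  intros Ha Hb.
  destruct (ImpInt_CInt (integrand1 a b z)
    (RtoC 2 * RtoC (sqrt PI) * Rcpow 2 (- (RtoC 2 * b)) * mittag_leffler a b (- z))%C) as [H1 H2].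
  { eapply ImpInt_ext; [| apply (subordination a z b (b + RtoC (1 / 2))%C (RtoC 2 * b)%C); [exact Ha | |]].
    - intros t Ht; unfold integrand1; do 3 f_equal.
      replace (1 / 2) with (1 - 1 / 2) at 1 by field; rewrite RtoC_minus; ring.
    - rewrite Re_plus; cbn [Re RtoC fst]; lra.
    - intros w; rewrite duplication_shift; do 3 f_equal; ring. }
  split; [exact H1 |].
  unfold rhs1; rewrite H2.
  assert (E : (Rcpow 2 (RtoC 2 * b - RtoC 1) * (RtoC 2 * Rcpow 2 (- (RtoC 2 * b))) = 1)%C).
  { rewrite <- (Rcpow_1 2) at 2 by lra; rewrite <- !Rcpow_plus.
    replace (_ + _)%C with (RtoC 0) by ring; apply Rcpow_0. }
  pose proof sqrt_PI_neq_0.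
  transitivity ((Rcpow 2 (RtoC 2 * b - RtoC 1) * (RtoC 2 * Rcpow 2 (- (RtoC 2 * b))))
    * mittag_leffler a b (- z))%C; [rewrite E; ring | field; assumption].
Qed.

Lemma mittag_leffler_eq_rhs2 (a z b : C) : 0 < Re a -> 1 / 2 < Re b ->
  ex_CInt_0_inf (integrand2 a b z) /\ mittag_leffler a b (- z)%C = rhs2 a b z.
Proof.
  intros Ha Hb.
  set (p := (b - RtoC (1 / 2))%C).
  assert (E2 : (RtoC 2 * p = RtoC 2 * b - RtoC 1)%C).
  { unfold p; transitivity (RtoC 2 * b - RtoC 2 * RtoC (1 / 2))%C; [ring |].
    rewrite <- RtoC_mult; do 2 f_equal; field. }
  destruct (ImpInt_CInt (integrand2 a b z)
    (RtoC 2 * RtoC (sqrt PI) * Rcpow 2 (- (RtoC 2 * p)) * mittag_leffler a b (- z))%C) as [H1 H2].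
  { eapply ImpInt_ext; [| apply (subordination a z b p (RtoC 2 * p)%C); [exact Ha | |]].
    - intros t Ht; unfold integrand2; rewrite E2; do 3 f_equal.
      unfold p; replace (3 / 2) with (1 / 2 + 1) by field; rewrite RtoC_plus; ring.
    - unfold p; rewrite Re_minus; cbn [Re RtoC fst]; lra.
    - intros w; rewrite duplication_shift, (Cmult_comm (rGamma (p + w))); do 3 f_equal.
      unfold p; ring. }
  split; [exact H1 |].
  unfold rhs2; rewrite H2, E2.
  assert (E : (Rcpow 2 (RtoC 2 * (b - RtoC 1)) * (RtoC 2 * Rcpow 2 (- (RtoC 2 * b - RtoC 1))) = 1)%C).
  { rewrite <- (Rcpow_1 2) at 2 by lra; rewrite <- !Rcpow_plus.
    replace (_ + _)%C with (RtoC 0) by (rewrite RtoC_2; ring); apply Rcpow_0. }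
  pose proof sqrt_PI_neq_0.
  transitivity ((Rcpow 2 (RtoC 2 * (b - RtoC 1)) * (RtoC 2 * Rcpow 2 (- (RtoC 2 * b - RtoC 1))))
    * mittag_leffler a b (- z))%C; [rewrite E; ring | field; assumption].
Qed.

(** On the boundary line the right-hand side is recovered from the open half-plane, where it
    agrees with a function continuous in b. *)
Lemma is_lim_half_plane_continuous (c : R) (f g : C -> C) (b : C) :
  (forall b' : C, c < Re b' -> g b' = f b') ->
  filterlim g (locally (T := C_R_NormedModule) b) (locally (T := C_R_NormedModule) (g b)) ->
  is_lim_half_plane c f b (g b).
Proof.
  intros E H; apply (filterlim_within_ext _ g f); [exact E |].
  eapply filterlim_filter_le_1; [apply filter_le_within | exact H].
Qed.

Theorem mainTheorem8 (a z : C) (ha : 0 < Re a) (hz : 0 <= Re z) :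
  (forall b : C, - (1 / 2) <= Re b ->
     (- (1 / 2) < Re b ->
        ex_CInt_0_inf (integrand1 a b z)
        /\ mittag_leffler a b (- z)%C = rhs1 a b z)
     /\ (Re b = - (1 / 2) ->
        is_lim_half_plane (- (1 / 2)) (fun b' => rhs1 a b' z) b
          (mittag_leffler a b (- z)%C)))
  /\ (forall b : C, 1 / 2 <= Re b ->
     (1 / 2 < Re b ->
        ex_CInt_0_inf (integrand2 a b z)
        /\ mittag_leffler a b (- z)%C = rhs2 a b z)
     /\ (Re b = 1 / 2 ->
        is_lim_half_plane (1 / 2) (fun b' => rhs2 a b' z) b
          (mittag_leffler a b (- z)%C)))
  /\ (let f := fun t : R =>
        (Rcpow t (RtoC (- (1 / 2))) * RtoC (exp (- t))
         * mittag_leffler1 (RtoC 2 * a) (- z * Rcpow (4 * t) a))%C in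
      ex_CInt_0_inf f
      /\ mittag_leffler1 a (- z)%C = (RtoC (/ sqrt PI) * CInt_0_inf f)%C).
Proof.
  split; [| split].
  - intros b _; split; [apply mittag_leffler_eq_rhs1, ha |]; intros _.
    apply (is_lim_half_plane_continuous _ _ (fun b' => mittag_leffler a b' (- z)%C)).
    + intros b' Hb'; apply mittag_leffler_eq_rhs1; assumption.
    + apply mittag_leffler_continuous, ha.
  - intros b _; split; [apply mittag_leffler_eq_rhs2, ha |]; intros _.
    apply (is_lim_half_plane_continuous _ _ (fun b' => mittag_leffler a b' (- z)%C)).
    + intros b' Hb'; apply mittag_leffler_eq_rhs2; assumption.
    + apply mittag_leffler_continuous, ha.
  - intros f.
    destruct (mittag_leffler_eq_rhs2 a z 1 ha) as [H1 H2]; [cbn; lra |].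
    assert (E : f = integrand2 a 1 z).
    { apply FunctionalExtensionality.functional_extensionality; intros t.
      unfold f, integrand2, mittag_leffler1; rewrite <- !RtoC_minus, <- RtoC_mult, <- RtoC_minus.
      replace (1 - 3 / 2) with (- (1 / 2)) by field.
      replace (2 * 1 - 1) with 1 by ring; reflexivity. }
    rewrite E; split; [exact H1 |].
    unfold mittag_leffler1; rewrite H2; unfold rhs2.
    replace (RtoC 2 * (1 - RtoC 1))%C with (RtoC 0) by ring.
    rewrite Rcpow_0, RtoC_inv by (apply Rgt_not_eq, sqrt_lt_R0, PI_RGT_0).
    unfold Cdiv; rewrite Cmult_1_l; reflexivity.
Qed.
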